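(* Let $0<\alpha<1/2$, $\beta>0$, $\Omega=[0,\alpha)\cup[\alpha+\beta,1+\beta)\subset\mathbb{R}$ and $g=\chi_\Omega$. Let $\Lambda\subset\mathbb{R}^2$ be a discrete countable set. If the Gabor system $\{g_\lambda\}_{\lambda\in\Lambda}$ is a Gabor orthonormal basis for $L^2(\mathbb{R})$, then $\Lambda$ is standard, i.e. $$\Lambda=\bigcup_{k\in\mathbb{Z}}\{k\}\times(\mathbb{Z}+a_k),$$ where $a_k\in[0,1)$ for every $k\in\mathbb{Z}$.
   Context: For $\lambda=(t,\nu)\in\mathbb{R}^2$ ($t$ the time coordinate, $\nu$ the frequency coordinate), $g_\lambda(x)=g(x-t)e^{2\pi i x\nu}$; the Gabor system associated to the window $g$ and the set $\Lambda$ is $\{g_\lambda\}_{\lambda\in\Lambda}$. In general, $\Lambda$ is called ($\Omega$-)standard if $\Lambda=\bigcup_{t\in J}\{t\}\times\Lambda_t$, where $\bigcup_{t\in J}(\Omega+t)=\mathbb{R}$ and, for every $t\in J$, the system $\{e^{2\pi i\lambda x}\}_{\lambda\in\Lambda_t}$ is an orthonormal basis for $L^2(\Omega+t)$ (equivalently, for $L^2(\Omega)$). Here $\mathbb{Z}+a_k=\{n+a_k:n\in\mathbb{Z}\}$.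
   Formalization: The displayed formula is proved with time coordinates t0+k for a common offset t0 in [0,1) in place of k; the formula with integer times is proved when some point of Λ has an integer time coordinate (it fails e.g. for β=1, Λ=(Z+1/2)×Z). *)

(* Defs.v *)
From mathcomp Require Import all_boot all_order all_algebra.
From mathcomp Require Import all_classical all_reals all_analysis.
From mathcomp Require Export complex.

Set Implicit Arguments.
Unset Strict Implicit.
Unset Printing Implicit Defensive.

Import Order.TTheory GRing.Theory Num.Theory numFieldNormedType.Exports.

Local Open Scope classical_set_scope.
Local Open Scope ring_scope.

Section ComplexL2.
Context {R : realType}.
Local Notation mu := (@lebesgue_measure R).
Local Notation C := (complex R).
Local Notation normc := (@ComplexField.Normc.normc R).

Definition norm2sq (A : set R) (f : R -> C) : \bar R :=
  (\int[mu]_(x in A) ((normc (f x)) ^+ 2)%:E)%E.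

(* Representatives of elements of L^2(A; C). *)
Definition memL2 (A : set R) (f : R -> C) : Prop :=
  [/\ measurable_fun A (fun x => complex.Re (f x)),
      measurable_fun A (fun x => complex.Im (f x)) &
      (norm2sq A f < +oo)%E].

(* Complex-valued Lebesgue integral, used on integrable functions only. *)
Definition cintegral (A : set R) (f : R -> C) : C :=
  Complex (Rintegral mu A (fun x => complex.Re (f x)))
          (Rintegral mu A (fun x => complex.Im (f x))).

Definition inner (A : set R) (f h : R -> C) : C :=
  cintegral A (fun x => f x * conjc (h x)).

(* Orthonormality as an indexed family: distinct indices give orthogonal
   functions. *)
Definition orthonormal (A : set R) (I : choiceType) (L : set I)
    (e : I -> R -> C) : Prop :=
  (forall i, L i -> memL2 A (e i)) /\
  (forall i j, L i -> L j -> inner A (e i) (e j) = (i == j)%:R).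

Definition span_dense (A : set R) (I : choiceType) (L : set I)
    (e : I -> R -> C) : Prop :=
  forall f : R -> C, memL2 A f -> forall eps : R, 0 < eps ->
  exists (s : seq I) (c : I -> C),
    (forall i, i \in s -> L i) /\
    (norm2sq A (fun x => f x - \sum_(i <- s) c i * e i x)%R < eps%:E)%E.

Definition orthonormal_basis (A : set R) (I : choiceType) (L : set I)
    (e : I -> R -> C) : Prop :=
  orthonormal A L e /\ span_dense A L e.

End ComplexL2.

Section Gabor.
Context {R : realType}.
Local Notation C := (complex R).

Definition expi (theta : R) : C := Complex (cos theta) (sin theta).

(* x |-> e^{2 pi i nu x} *)
Definition character (nu : R) (x : R) : C := expi (2 * pi * nu * x).

(* g_lambda for lambda = (t, nu): time coordinate first. *)
Definition gabor (g : R -> C) (lambda : R * R) (x : R) : C :=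
  g (x - lambda.1) * character lambda.2 x.

Definition gabor_onb (g : R -> C) (Lambda : set (R * R)) : Prop :=
  orthonormal_basis setT Lambda (gabor g).

Definition chi (Omega : set R) (x : R) : C := Complex (\1_Omega x) 0.

Definition translate (Omega : set R) (t : R) : set R :=
  [set x + t | x in Omega].

Definition standard (Omega : set R) (Lambda : set (R * R)) : Prop :=
  exists (J : set R) (Lt : R -> set R),
    [/\ Lambda = \bigcup_(t in J) ([set t] `*` Lt t),
        \bigcup_(t in J) translate Omega t = setT &
        forall t, J t -> orthonormal_basis (translate Omega t) (Lt t) character].

Definition two_intervals (alpha beta : R) : set R :=
  `[0, alpha[%classic `|` `[alpha + beta, 1 + beta[%classic.

Definition intshift (a : R) : set R := [set n%:~R + a | n in [set: int]].

(* The union over k of {t0 + k} x (Z + a_k).  If Lambda generates a Gabor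
   orthonormal basis, so does Lambda + (s, 0) for every real s; hence the time
   coordinates are integers only up to a common offset t0.  With t0 in [0, 1),
   t0 = 0 exactly when some point has an integer time coordinate. *)
Definition integer_fibres (t0 : R) (a : int -> R) : set (R * R) :=
  \bigcup_(k in [set: int]) ([set t0 + k%:~R] `*` intshift (a k)).

End Gabor.

(* Main.v *)
(* Write [g] for the window, [h] for the indicator of [0, 1) and
   [Psi u = |<h, g_u>|^2].  Completeness, tested on the time-frequency shifts of [h],
   gives [\sum_(l in Lambda) Psi (l - z) >= 1] for every [z], while Bessel's inequality
   on unit intervals gives [\int Psi <= 1].  If the translates [D + l] are pairwise
   disjoint, integrating the first inequality over [- D] yields [|D| <= 1], and when
   [|D| = 1] no box can avoid [D + Lambda].
   The translates are disjoint as soon as the Fourier transform of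
   [Omega `&` (Omega + d)] at [m] does not vanish for [(d, m)] in [D - D].
   If [beta < 1 - alpha], this holds for a rectangle [0, 1 + beta) x [0, H) of area
   greater than 1, so no basis exists.  Otherwise it holds for [D = Omega x [0, 1)], so
   [D + Lambda] tiles the plane and every horizontal slice is a tiling of the line by
   translates of [Omega].  Such a tiling is [c + Z], with [beta] an integer.  Finally [c]
   is the same for all slices, because points of [Lambda] whose times differ by an amount
   in [(beta, 1 + beta)] have frequencies at distance at least 2. *)

(* The height of [D] is limited by cancellation. An overlap of two windows is a union of at most
   three intervals, and for small [|m|] the transform of each is a positive factor, fixed by its
   length, times the phase of its centre. Two intervals cancel only if their lengths agree and their
   centres are at least [1 / (2 |m|)] apart. With a long gap the relevant overlaps have one piece,
   or two of different lengths because [alpha < 1/2], so every [|m| < 1] is admissible. With a short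
   gap equal lengths do occur, for centres up to [(1 + beta - alpha) / 2] apart, and this fixes the
   height of the rectangle.

   Measure estimates alone would give a covering up to a null set. As all intervals are closed on
   the left and open on the right, an uncovered point has an uncovered square to its upper right,
   and after recentring [Psi] has positive integral there. So the covering holds at every point, and
   each single slice can be analysed. *)
From HB Require Import structures.
Require Import Defs.
From mathcomp Require Import all_boot all_order all_algebra.
From mathcomp Require Import all_classical all_reals all_analysis.
From mathcomp Require Import measurable_realfun ring lra.
Import Order.TTheory GRing.Theory Num.Theory numFieldNormedType.Exports.
Local Open Scope classical_set_scope.
Local Open Scope ring_scope.
Set Implicit Arguments.
Unset Strict Implicit.
Unset Printing Implicit Defensive.

(** * Translation invariance of Lebesgue integrals *)

Section Translation.
Context {R : realType}.
Local Notation mu := (@lebesgue_measure R).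
Local Open Scope ereal_scope.

Lemma measurable_addr (c : R) : measurable_fun [set: R] (fun x => x + c)%R.
Proof. by apply: measurable_funD => //; exact: measurable_id. Qed.

Lemma lebesgue_measure_shift (c : R) (A : set R) : measurable A ->
  pushforward mu ((fun x : R => x + c)%R : _ -> measurableTypeR R) A = mu A.
Proof.
have mc := measurable_addr c.
(* The translation is bundled as a measurable function so that its pushforward is a measure, to
   which uniqueness of Lebesgue measure applies. *)
pose mc_mixin := isMeasurableFun.Build _ _ (measurableTypeR R) (measurableTypeR R) _ mc.
pose mc_pack : {mfun measurableTypeR R >-> measurableTypeR R} :=
  HB.pack (fun x : R => x + c)%R mc_mixin.
move=> mA; apply/esym.
apply: (@lebesgue_measure_unique R (pushforward mu mc_pack : {measure set (measurableTypeR R) -> \bar R}) _ A mA).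
move=> _ [[a b]] _ <-.
rewrite -[RHS]/(mu ((fun x : R => x + c)%R @^-1` `]a, b])).
have -> : (fun x : R => x + c)%R @^-1` `]a, b] = `](a - c)%R, (b - c)%R]%classic.
  apply/seteqP; split => x /=; rewrite !in_itv/= => /andP[h1 h2]; apply/andP; split; lra.
rewrite !lebesgue_measure_itv/= !lte_fin ltrD2r; case: ifPn => // _.
by rewrite -!EFinB; congr (_%:E); ring.
Qed.

Lemma ge0_integral_shift (c : R) (f : R -> \bar R) : measurable_fun setT f ->
  (forall x, 0 <= f x) -> \int[mu]_x f (x + c)%R = \int[mu]_x f x.
Proof.
move=> mf f0.
rewrite -[LHS]/(\int[mu]_(x in (fun x : R => x + c)%R @^-1` setT)
  (f \o (fun x : R => x + c)%R : measurableTypeR R -> _) x).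
rewrite -(@ge0_integral_pushforward _ _ (measurableTypeR R) (measurableTypeR R)
  R _ (measurable_addr c) mu)//.
apply: eq_measure_integral; first exact: measurable_addr.
by move=> ? A mA _; exact: lebesgue_measure_shift.
Qed.

Lemma ge0_integral_shift2 (c : R * R) (f : R * R -> \bar R) :
  measurable_fun setT f -> (forall x, 0 <= f x) ->
  \int[mu \x mu]_u f (u.1 + c.1, u.2 + c.2)%R = \int[mu \x mu]_u f u.
Proof.
move=> mf f0.
have mc : measurable_fun [set: R * R] (fun u : R * R => (u.1 + c.1, u.2 + c.2)%R).
  apply/measurable_fun_pairP; split.
    exact: (measurable_funD measurable_fst (@measurable_cst _ _ _ _ _ c.1)).
  exact: (measurable_funD measurable_snd (@measurable_cst _ _ _ _ _ c.2)).
rewrite !fubini_tonelli1//; last exact: measurableT_comp mf mc.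
rewrite /fubini_F/=.
rewrite -[RHS](@ge0_integral_shift c.1)//=.
- apply: eq_integral => x _.
  rewrite -[RHS](@ge0_integral_shift c.2)//=.
  exact: measurableT_comp mf (measurable_pair1 _).
- exact: measurable_fun_fubini_tonelli_F.
- by move=> x; apply: integral_ge0.
Qed.

End Translation.

(** * Inner products of bounded functions with compact support *)

Section ComplexParts.
Context {R : realType}.
Local Notation C := (complex R).
Implicit Types x y : C.

Lemma ReD x y : complex.Re (x + y) = complex.Re x + complex.Re y.
Proof. by case: x => a b; case: y => c d. Qed.
Lemma ImD x y : complex.Im (x + y) = complex.Im x + complex.Im y.
Proof. by case: x => a b; case: y => c d. Qed.
Lemma ReN x : complex.Re (- x) = - complex.Re x.
Proof. by case: x => a b. Qed.
Lemma ImN x : complex.Im (- x) = - complex.Im x.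
Proof. by case: x => a b. Qed.
Lemma ReM x y : complex.Re (x * y) =
  complex.Re x * complex.Re y - complex.Im x * complex.Im y.
Proof. by case: x => a b; case: y => c d. Qed.
Lemma ImM x y : complex.Im (x * y) =
  complex.Re x * complex.Im y + complex.Im x * complex.Re y.
Proof. by case: x => a b; case: y => c d. Qed.
Lemma ReJ x : complex.Re (conjc x) = complex.Re x.
Proof. by case: x. Qed.
Lemma ImJ x : complex.Im (conjc x) = - complex.Im x.
Proof. by case: x. Qed.
Lemma complex_ext x y : complex.Re x = complex.Re y -> complex.Im x = complex.Im y -> x = y.
Proof. by case: x => a b; case: y => c d /= -> ->. Qed.

(** The squared modulus as a polynomial in the parts, free of the square root in [normc], so that
    [ring] can work on it. *)
Definition sqnorm x : R := complex.Re x ^+ 2 + complex.Im x ^+ 2.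

Lemma sqnorm_ge0 x : 0 <= sqnorm x.
Proof. by rewrite addr_ge0 ?sqr_ge0. Qed.
Lemma sqnormE x : ComplexField.Normc.normc x ^+ 2 = sqnorm x.
Proof. by case: x => a b /=; rewrite sqr_sqrtr ?addr_ge0 ?sqr_ge0. Qed.
Lemma mulJ x : x * conjc x = Complex (sqnorm x) 0.
Proof. by case: x => a b; apply: complex_ext; rewrite /sqnorm /=; ring. Qed.
Lemma sqnormM x y : sqnorm (x * y) = sqnorm x * sqnorm y.
Proof. by case: x => a b; case: y => c d; rewrite /sqnorm /=; ring. Qed.
Lemma conjcM x y : conjc (x * y) = conjc x * conjc y.
Proof. by case: x => a b; case: y => c d; apply: complex_ext => /=; ring. Qed.
Lemma conjcD x y : conjc (x + y) = conjc x + conjc y.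
Proof. by case: x => a b; case: y => c d; apply: complex_ext => /=; ring. Qed.
Lemma conjcKK x : conjc (conjc x) = x.
Proof. by case: x => a b; apply: complex_ext => /=; ring. Qed.
Lemma sqnorm_expi (t : R) : sqnorm (expi t) = 1.
Proof. by rewrite /sqnorm /= cos2Dsin2. Qed.

End ComplexParts.

Section BoundedCompactSupport.
Context {R : realType}.
Local Notation mu := (@lebesgue_measure R).
Local Notation C := (complex R).

(** One constant bounds both the values and the support. The class is closed under sums and products
    and consists of integrable functions, so inner products can be expanded freely; boxes, Gabor
    functions and their finite combinations have parts in it. *)
Definition bcs (u : R -> R) := exists M : R,
  [/\ measurable_fun setT u, forall x, `|u x| <= M & forall x, M < `|x| -> u x = 0].

Lemma bcsD (u v : R -> R) : bcs u -> bcs v -> bcs (fun x => u x + v x).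
Proof.
move=> [M [mu1 u1 u2]] [N [mv v1 v2]]; exists (`|M| + `|N|); split.
- exact: measurable_funD.
- move=> x; apply: le_trans (ler_normD _ _) _; apply: lerD.
    exact: le_trans (u1 x) (ler_norm _).
  exact: le_trans (v1 x) (ler_norm _).
- move=> x h; have := ler_norm M; have := ler_norm N.
  have := normr_ge0 M; have := normr_ge0 N => ? ? ? ?.
  by rewrite u2 ?v2 ?addr0//; lra.
Qed.

Lemma bcsM (u v : R -> R) : bcs u -> bcs v -> bcs (fun x => u x * v x).
Proof.
move=> [M [mu1 u1 u2]] [N [mv v1 v2]]; exists (`|M| * `|N| + `|M|).
have M0 := normr_ge0 M; have N0 := normr_ge0 N.
split.
- exact: measurable_funM.
- move=> x; rewrite normrM; apply: (@le_trans _ _ (`|M| * `|N|)); last by rewrite lerDl.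
  apply: ler_pM => //; [exact: le_trans (u1 x) (ler_norm _)|exact: le_trans (v1 x) (ler_norm _)].
- move=> x h; rewrite u2 ?mul0r//; apply: le_lt_trans h.
  by apply: le_trans (ler_norm _) _; rewrite lerDr mulr_ge0.
Qed.

Lemma bcsZ (k : R) (u : R -> R) : bcs u -> bcs (fun x => k * u x).
Proof.
move=> [M [mu1 u1 u2]]; exists (`|k| * `|M| + `|M|).
split.
- apply: measurable_funM => //.
- move=> x; rewrite normrM; apply: (@le_trans _ _ (`|k| * `|M|)); last by rewrite lerDl.
  apply: ler_pM => //; exact: le_trans (u1 x) (ler_norm _).
- move=> x h; rewrite u2 ?mulr0//; apply: le_lt_trans h.
  by apply: le_trans (ler_norm _) _; rewrite lerDr mulr_ge0.
Qed.

Lemma bcs_ext (u v : R -> R) : bcs u -> u =1 v -> bcs v.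
Proof. by move=> + /funext <-. Qed.

Lemma bcsN (u : R -> R) : bcs u -> bcs (fun x => - u x).
Proof. by move=> /(bcsZ (-1)) h; apply: bcs_ext h _ => x; rewrite mulN1r. Qed.

Lemma bcs0 : bcs (fun=> 0).
Proof. by exists 0; split => // x; rewrite normr0. Qed.

Lemma bcs_integrable (u : R -> R) : bcs u -> mu.-integrable setT (EFin \o u).
Proof.
move=> [M [mu1 u1 u2]].
apply: (@le_integrable _ _ R mu setT measurableT _
  (fun x => M%:E * (\1_(`[- M, M]%classic) x)%:E)%E).
- exact/measurable_EFinP.
- move=> x _ /=; rewrite lee_fin indicE.
  case: (leP `|x| M) => xM.
    rewrite mem_set ?mulr1 ?(le_trans (u1 x)) ?ler_norm//.
    by rewrite /= in_itv/= -ler_norml.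
  by rewrite u2// normr0.
- apply: integrableZl => //; exact: integrable_indic_itv.
Qed.

Definition bcsC (f : R -> C) := bcs (fun x => complex.Re (f x)) /\ bcs (fun x => complex.Im (f x)).

Lemma bcsC_ext (f g : R -> C) : bcsC f -> f =1 g -> bcsC g.
Proof. by move=> + /funext <-. Qed.

Lemma bcsCD (f g : R -> C) : bcsC f -> bcsC g -> bcsC (fun x => f x + g x).
Proof.
move=> [f1 f2] [g1 g2]; split.
  by apply: bcs_ext (bcsD f1 g1) _ => x /=; rewrite ReD.
by apply: bcs_ext (bcsD f2 g2) _ => x /=; rewrite ImD.
Qed.

Lemma bcsCM (f g : R -> C) : bcsC f -> bcsC g -> bcsC (fun x => f x * g x).
Proof.
move=> [f1 f2] [g1 g2]; split.
  by apply: bcs_ext (bcsD (bcsM f1 g1) (bcsN (bcsM f2 g2))) _ => x /=; rewrite ReM.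
by apply: bcs_ext (bcsD (bcsM f1 g2) (bcsM f2 g1)) _ => x /=; rewrite ImM.
Qed.

Lemma bcsCZ (k : C) (f : R -> C) : bcsC f -> bcsC (fun x => k * f x).
Proof.
move=> [f1 f2]; split.
  by apply: bcs_ext (bcsD (bcsZ (complex.Re k) f1) (bcsN (bcsZ (complex.Im k) f2))) _ => x /=; rewrite ReM.
by apply: bcs_ext (bcsD (bcsZ (complex.Re k) f2) (bcsZ (complex.Im k) f1)) _ => x /=; rewrite ImM.
Qed.

Lemma bcsCJ (f : R -> C) : bcsC f -> bcsC (fun x => conjc (f x)).
Proof.
move=> [f1 f2]; split; first by apply: bcs_ext f1 _ => x /=; rewrite ReJ.
by apply: bcs_ext (bcsN f2) _ => x /=; rewrite ImJ.
Qed.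

Lemma bcsC_sum (I : Type) (s : seq I) (f : I -> R -> C) :
  (forall i, bcsC (f i)) -> bcsC (fun x => \sum_(i <- s) f i x).
Proof.
move=> fi; elim: s => [|i s ih].
  by apply: (@bcsC_ext (fun=> 0)) => [|x]; rewrite ?big_nil//; split; exact: bcs0.
by apply: bcsC_ext (bcsCD (fi i) ih) _ => x; rewrite big_cons.
Qed.

Local Notation ip := (@inner R setT).

Lemma cintegralD (f g : R -> C) : bcsC f -> bcsC g ->
  cintegral setT (fun x => f x + g x) = cintegral setT f + cintegral setT g.
Proof.
move=> [f1 f2] [g1 g2]; apply: complex_ext; rewrite /cintegral ?ReD ?ImD /=.
  under eq_Rintegral do rewrite ReD.
  by apply: RintegralD => //; exact: bcs_integrable.
under eq_Rintegral do rewrite ImD.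
by apply: RintegralD => //; exact: bcs_integrable.
Qed.

Lemma cintegralZ (k : C) (f : R -> C) : bcsC f ->
  cintegral setT (fun x => k * f x) = k * cintegral setT f.
Proof.
move=> [f1 f2]; apply: complex_ext; rewrite /cintegral ?ReM ?ImM /=.
  under eq_Rintegral do rewrite ReM.
  by rewrite RintegralB ?RintegralZl//; apply: bcs_integrable; try exact: bcsZ.
under eq_Rintegral do rewrite ImM.
by rewrite RintegralD ?RintegralZl//; apply: bcs_integrable; try exact: bcsZ.
Qed.

Lemma cintegralJ (f : R -> C) : bcsC f ->
  cintegral setT (fun x => conjc (f x)) = conjc (cintegral setT f).
Proof.
move=> [f1 f2]; apply: complex_ext; rewrite /cintegral ?ReJ ?ImJ /=.
  by apply: eq_Rintegral => x _; rewrite ReJ.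
under eq_Rintegral do rewrite ImJ -mulN1r.
by rewrite RintegralZl ?mulN1r//; exact: bcs_integrable.
Qed.

Lemma innerDl (f g h : R -> C) : bcsC f -> bcsC g -> bcsC h ->
  ip (fun x => f x + g x) h = ip f h + ip g h.
Proof.
move=> ? ? /bcsCJ ?; rewrite /inner -cintegralD; try exact: bcsCM.
by congr cintegral; apply/funext => x; rewrite mulrDl.
Qed.

Lemma innerZl (k : C) (f h : R -> C) : bcsC f -> bcsC h ->
  ip (fun x => k * f x) h = k * ip f h.
Proof.
move=> ? /bcsCJ ?; rewrite /inner -cintegralZ; last exact: bcsCM.
by congr cintegral; apply/funext => x; rewrite mulrA.
Qed.

Lemma innerC (f h : R -> C) : bcsC f -> bcsC h -> ip h f = conjc (ip f h).
Proof.
move=> ? /bcsCJ ?; rewrite /inner -cintegralJ; last exact: bcsCM.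
by congr cintegral; apply/funext => x; rewrite conjcM conjcKK mulrC.
Qed.

Lemma inner_suml (I : Type) (s : seq I) (f : I -> R -> C) (h : R -> C) :
  (forall i, bcsC (f i)) -> bcsC h ->
  ip (fun x => \sum_(i <- s) f i x) h = \sum_(i <- s) ip (f i) h.
Proof.
move=> fi hh; elim: s => [|i s ih].
  transitivity (ip (fun x => 0 * h x) h); last by rewrite innerZl// mul0r big_nil.
  by congr inner; apply/funext => x; rewrite mul0r big_nil.
rewrite big_cons -ih -innerDl//; last exact: bcsC_sum.
by congr inner; apply/funext => x; rewrite big_cons.
Qed.

Lemma norm2sq_inner (f : R -> C) : bcsC f -> norm2sq setT f = (complex.Re (ip f f))%:E.
Proof.
move=> [f1 f2]; rewrite /norm2sq /inner /cintegral /=.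
have H : bcs (fun x => sqnorm (f x)).
  by apply: bcs_ext (bcsD (bcsM f1 f1) (bcsM f2 f2)) _ => x; rewrite /sqnorm !expr2.
under eq_integral do rewrite sqnormE.
rewrite -[LHS]fineK; last exact: (integrable_fin_num _ (bcs_integrable H)).
by congr (_%:E); apply: eq_Rintegral => x _; rewrite mulJ.
Qed.

Lemma inner_self_ge0 (f : R -> C) : bcsC f -> 0 <= complex.Re (ip f f).
Proof.
by move=> /norm2sq_inner h; rewrite -lee_fin -h; apply: integral_ge0 => x _; rewrite lee_fin sqr_ge0.
Qed.

End BoundedCompactSupport.

(** * Bessel's inequality and orthogonal projection *)

Section Bessel.
Context {R : realType}.
Local Notation C := (complex R).
Local Notation ip := (@inner R setT).
Implicit Types f g h : R -> C.

Lemma innerDr f g h : bcsC f -> bcsC g -> bcsC h ->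
  ip h (fun x => f x + g x) = ip h f + ip h g.
Proof.
move=> ? ? ?; rewrite innerC ?innerDl ?conjcD//; last exact: bcsCD.
by congr (_ + _); rewrite -innerC.
Qed.

Lemma innerNl f h : bcsC f -> bcsC h -> ip (fun x => - f x) h = - ip f h.
Proof.
move=> ? ?; rewrite -mulN1r -innerZl//; congr inner.
by apply/funext => x; rewrite mulN1r.
Qed.

Lemma bcsCN f : bcsC f -> bcsC (fun x => - f x).
Proof. by move=> /(bcsCZ (-1)) h; apply: bcsC_ext h _ => x; rewrite mulN1r. Qed.

Lemma bcsCB f g : bcsC f -> bcsC g -> bcsC (fun x => f x - g x).
Proof. by move=> hf /bcsCN; exact: bcsCD. Qed.

Context {I : choiceType} (e : I -> R -> C) (s : seq I).
Hypothesis bcs_e : forall i, bcsC (e i).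
Hypothesis s_uniq : uniq s.
Hypothesis e_orth : forall i j, i \in s -> j \in s -> ip (e i) (e j) = (i == j)%:R.
Variable f : R -> C.
Hypothesis bcs_f : bcsC f.

Let comb (c : I -> C) (r : seq I) x := \sum_(i <- r) c i * e i x.
Let proj := comb (fun i => ip f (e i)) s.

Let bcs_comb c r : bcsC (comb c r).
Proof. by apply: bcsC_sum => i; exact: bcsCZ. Qed.

Let bcs_proj : bcsC proj. Proof. exact: bcs_comb. Qed.
Let bcs_Nproj : bcsC (fun x => - proj x). Proof. exact: bcsCN. Qed.
Let bcs_res : bcsC (fun x => f x - proj x). Proof. exact: bcsCB. Qed.

Let inner_comb c r h : bcsC h -> ip (comb c r) h = \sum_(i <- r) c i * ip (e i) h.
Proof.
move=> hh; rewrite inner_suml//; last by move=> i; exact: bcsCZ.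
by apply: eq_bigr => i _; rewrite innerZl.
Qed.

Let proj_orth i : i \in s -> ip (fun x => f x - proj x) (e i) = 0.
Proof.
move=> si; rewrite innerDl ?innerNl//.
rewrite inner_comb// (bigD1_seq i)//= e_orth// eqxx mulr1 big_seq_cond big1 ?addr0 ?subrr//.
by move=> j /andP[sj ji]; rewrite e_orth// (negbTE ji) mulr0.
Qed.

Let comb_orth c r : {subset r <= s} -> ip (comb c r) (fun x => f x - proj x) = 0.
Proof.
move=> rs; rewrite inner_comb; last by apply: bcsCB.
rewrite big_seq big1// => i ir; rewrite innerC// ?proj_orth ?conjc0 ?mulr0//; exact: rs.
Qed.

Let pyth f1 f2 : bcsC f1 -> bcsC f2 -> ip f1 f2 = 0 ->
  complex.Re (ip (fun x => f1 x + f2 x) (fun x => f1 x + f2 x)) =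
  complex.Re (ip f1 f1) + complex.Re (ip f2 f2).
Proof.
move=> h1 h2 h; rewrite innerDl ?innerDr//; last exact: bcsCD.
by rewrite (innerC h1 h2) h conjc0 addr0 add0r ReD.
Qed.

Let proj_norm : complex.Re (ip proj proj) = \sum_(i <- s) sqnorm (ip f (e i)).
Proof.
rewrite {1}/proj inner_comb//.
rewrite (_ : \sum_(i <- s) _ = \sum_(i <- s) Complex (sqnorm (ip f (e i))) 0).
  elim: s => [|i r ih]; first by rewrite !big_nil.
  by rewrite !big_cons ReD ih.
rewrite big_seq [RHS]big_seq; apply: eq_bigr => i si.
rewrite -mulJ; congr (_ * _).
(* The residual is orthogonal to [e i], so [proj] and [f] have the same coefficient there. *)
rewrite -innerC//; have := proj_orth si.
rewrite innerDl ?innerNl//.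
move=> /eqP; rewrite subr_eq0 => /eqP fp.
by rewrite innerC// -fp -innerC.
Qed.

Lemma bessel_residual : complex.Re (ip (fun x => f x - proj x) (fun x => f x - proj x)) =
  complex.Re (ip f f) - \sum_(i <- s) sqnorm (ip f (e i)).
Proof.
apply/eqP; rewrite eq_sym subr_eq addrC -proj_norm -pyth ?comb_orth//.
by apply/eqP; congr (complex.Re (ip _ _)); apply/funext => x; rewrite addrC subrK.
Qed.

Lemma bessel : \sum_(i <- s) sqnorm (ip f (e i)) <= complex.Re (ip f f).
Proof. by rewrite -subr_ge0 -bessel_residual inner_self_ge0//; exact: bcsCB. Qed.

(** Pythagoras for the splitting of the error into [proj - comb c r] and the residual of the
    projection. The list [r] may repeat entries, as a list obtained from [span_dense] may. *)
Lemma best_approximation (c : I -> C) (r : seq I) : {subset r <= s} ->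
  let g x := f x - \sum_(i <- r) c i * e i x in
  complex.Re (ip f f) - \sum_(i <- s) sqnorm (ip f (e i)) <= complex.Re (ip g g).
Proof.
move=> rs; set g := (fun x => f x - \sum_(i <- r) c i * e i x); rewrite -/g /=.
have bD : bcsC (fun x => proj x - comb c r x) by apply: bcsCB; exact: bcs_comb.
have -> : g = (fun x => (proj x - comb c r x) + (f x - proj x)).
  by apply/funext => x; rewrite /g /comb; ring.
have bNc : bcsC (fun x => - comb c r x) by exact: bcsCN.
have bD0 : ip (fun x => proj x - comb c r x) (fun x => f x - proj x) = 0.
  by rewrite (innerDl bcs_proj bNc bcs_res) innerNl// !comb_orth// subr0.
rewrite -bessel_residual; suff : complex.Re (ip (fun x => f x - proj x) (fun x => f x - proj x)) <=
  complex.Re (ip (fun x => proj x - comb c r x) (fun x => proj x - comb c r x)) +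
  complex.Re (ip (fun x => f x - proj x) (fun x => f x - proj x)).
  by rewrite -(pyth bD bcs_res bD0).
by rewrite lerDr inner_self_ge0.
Qed.

End Bessel.

(** * Modulated indicators of intervals *)

Section Boxes.
Context {R : realType}.
Local Notation mu := (@lebesgue_measure R).
Local Notation C := (complex R).
Local Notation ip := (@inner R setT).

Lemma integral_FTC_itv (F f : R -> R) (a b : R) : a < b ->
  (forall x : R, is_derive x (1 : R) F (f x)) -> continuous f ->
  (\int[mu]_(x in `[a, b]) (f x)%:E = (F b - F a)%:E)%E.
Proof.
move=> ab dF cf.
have cF : continuous F.
  move=> x; apply: differentiable_continuous; apply/derivable1_diffP.
  by have [] := dF x.
rewrite (@continuous_FTC2 _ f F)//.
- exact: continuous_subspaceT.
- split.
  + by move=> x _; have [] := dF x.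
  + by apply: cvg_at_right_filter; exact: cF.
  + by apply: cvg_at_left_filter; exact: cF.
- by move=> x _; rewrite derive1E; have [_ ->] := dF x.
Qed.

Lemma continuous_cosM (k : R) : continuous (fun x => cos (k * x)).
Proof.
move=> x; apply: (@continuous_comp _ _ _ (fun x => k * x) cos).
  exact: mulrl_continuous.
exact: continuous_cos.
Qed.

Lemma continuous_sinM (k : R) : continuous (fun x => sin (k * x)).
Proof.
move=> x; apply: (@continuous_comp _ _ _ (fun x => k * x) sin).
  exact: mulrl_continuous.
exact: continuous_sin.
Qed.

Lemma Rintegral_indic_co (f : R -> R) (a b : R) : continuous f ->
  Rintegral mu setT (fun x => \1_(`[a, b[%classic) x * f x) =
  Rintegral mu `[a, b] f.
Proof.
move=> cf.
have -> : (fun x => \1_(`[a, b[%classic) x * f x) = f \_ (`[a, b[%classic).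
  by apply/funext => x; rewrite patchE indicE; case: ifPn; rewrite ?mul1r ?mul0r.
rewrite -Rintegral_mkcond Rintegral_itv_bndo_bndc//.
have H : mu.-integrable `[a, b] (EFin \o f).
  apply: continuous_compact_integrable; first exact: segment_compact.
  exact: continuous_subspaceT.
apply: integrableS H => //.
by move=> x /=; rewrite !in_itv/= => /andP[-> /ltW].
Qed.

Lemma Rintegral_cos (k a b : R) : a < b -> k != 0 ->
  Rintegral mu `[a, b] (fun x => cos (k * x)) = (sin (k * b) - sin (k * a)) / k.
Proof.
move=> ab k0; have dF (x : R) : is_derive x (1 : R) (fun x => sin (k * x) / k) (cos (k * x)).
  by apply: is_derive_eq; rewrite /GRing.scale/=; field.
by rewrite /Rintegral (integral_FTC_itv ab dF (@continuous_cosM k))/= mulrBl.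
Qed.

Lemma Rintegral_sin (k a b : R) : a < b -> k != 0 ->
  Rintegral mu `[a, b] (fun x => sin (k * x)) = (cos (k * a) - cos (k * b)) / k.
Proof.
move=> ab k0; have dF (x : R) : is_derive x (1 : R) (fun x => - cos (k * x) / k) (sin (k * x)).
  by apply: is_derive_eq; rewrite /GRing.scale/=; field.
by rewrite /Rintegral (integral_FTC_itv ab dF (@continuous_sinM k))/=; field.
Qed.

Definition box (a b nu : R) (x : R) : C := chi `[a, b[%classic x * character nu x.

(** The closed form of the integral of the character of frequency [m] over [[a, b)], as
    [cintegral_box] shows. The value 0 for [b <= a] lets empty overlaps be treated like the
    others. *)
Definition expint (a b m : R) : C :=
  if a < b then
    if m == 0 then Complex (b - a) 0 else
    Complex ((sin (2 * pi * m * b) - sin (2 * pi * m * a)) / (2 * pi * m))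
            ((cos (2 * pi * m * a) - cos (2 * pi * m * b)) / (2 * pi * m))
  else 0.

Lemma bcs_box1 (a b : R) (f : R -> R) : continuous f -> (forall x, `|f x| <= 1) ->
  bcs (fun x => \1_(`[a, b[%classic) x * f x).
Proof.
move=> cf f1; exists (1 + `|a| + `|b|).
have a0 := normr_ge0 a; have b0 := normr_ge0 b; split.
- by apply: measurable_funM => //; exact: continuous_measurable_fun.
- move=> x; rewrite normrM indicE; case: (x \in _) => /=; rewrite ?normr1 ?normr0; last lra.
  by have := f1 x; lra.
- move=> x h; rewrite indicE memNset ?mul0r//= in_itv/= => /andP[h1 h2].
  have := ler_norm x; have := ler_norm (- x); have := ler_norm b; have := ler_norm (- a).
  move: h; rewrite !normrN.
  by case: (ger0P x) => ?; lra.
Qed.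

Lemma boxE (a b nu : R) x : box a b nu x =
  Complex (\1_(`[a, b[%classic) x * cos (2 * pi * nu * x)) (\1_(`[a, b[%classic) x * sin (2 * pi * nu * x)).
Proof. by rewrite /box /chi /character /expi; apply: complex_ext; rewrite ?ReM ?ImM /=; ring. Qed.

Lemma bcsC_box a b nu : bcsC (box a b nu).
Proof.
split.
  apply: bcs_ext (bcs_box1 a b (@continuous_cosM (2 * pi * nu)) _) _ => x; first exact: cos_max.
  by rewrite boxE.
apply: bcs_ext (bcs_box1 a b (@continuous_sinM (2 * pi * nu)) _) _ => x; first exact: sin_max.
by rewrite boxE.
Qed.

Lemma box_mulJ a b nu a' b' nu' x : box a b nu x * conjc (box a' b' nu' x) =
  box (Num.max a a') (Num.min b b') (nu - nu') x.
Proof.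
rewrite !boxE.
have -> : 2 * pi * (nu - nu') * x = 2 * pi * nu * x - 2 * pi * nu' * x by ring.
rewrite cosB sinB.
have -> : \1_(`[Num.max a a', Num.min b b'[%classic) x =
   \1_(`[a, b[%classic) x * \1_(`[a', b'[%classic) x :> R.
  rewrite !indicE !mem_setE !in_itv/= ge_max lt_min.
  by do ! case: (_ <= _); do ! case: (_ < _); rewrite /= ?mulr1 ?mulr0 ?mul0r.
by apply: complex_ext; rewrite ?ReM ?ImM /=; ring.
Qed.

Lemma cintegral_box a b m : cintegral setT (box a b m) = expint a b m.
Proof.
rewrite /cintegral.
rewrite (_ : (fun x => complex.Re _) = (fun x => \1_(`[a, b[%classic) x * cos (2 * pi * m * x))); last first.
  by apply/funext => x; rewrite boxE.
rewrite (_ : (fun x => complex.Im _) = (fun x => \1_(`[a, b[%classic) x * sin (2 * pi * m * x))); last first.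
  by apply/funext => x; rewrite boxE.
rewrite !Rintegral_indic_co; try exact: continuous_cosM; try exact: continuous_sinM.
rewrite /expint; case: ltP => ab; last first.
  rewrite /Rintegral; move: ab; rewrite le_eqVlt => /orP[/eqP ->|ba].
    by rewrite set_itv1 !integral_set1.
  by rewrite set_itv_ge ?integral_set0//= bnd_simp -ltNge.
have [->|m0] := eqVneq m 0.
  under eq_Rintegral do rewrite mulr0 mul0r cos0.
  under [X in Complex _ X]eq_Rintegral do rewrite mulr0 mul0r sin0.
  rewrite !Rintegral_cst// mul0r mul1r.
  congr Complex; rewrite -[RHS]/(fine (b - a)%:E); congr fine.
  by apply: (etrans (lebesgue_measure_itv `[a, b])); rewrite /= lte_fin ab.
have k0 : 2 * pi * m != 0 by rewrite !mulf_neq0// ?gt_eqF ?pi_gt0.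
by rewrite Rintegral_cos// Rintegral_sin.
Qed.

Lemma inner_box a b nu a' b' nu' : ip (box a b nu) (box a' b' nu') =
  expint (Num.max a a') (Num.min b b') (nu - nu').
Proof.
rewrite -cintegral_box; congr cintegral; apply/funext => x; exact: box_mulJ.
Qed.

End Boxes.

(** * Lower Parseval bound from density *)

Section Parseval.
Context {R : realType}.
Local Notation mu := (@lebesgue_measure R).
Local Notation C := (complex R).
Local Notation ip := (@inner R setT).

Lemma memL2_bcs (f : R -> C) : bcsC f -> memL2 setT f.
Proof.
move=> ff; have := norm2sq_inner ff => E.
case: (ff) => [[M [m1 _ _]] [N [m2 _ _]]]; split => //.
by rewrite E ltry.
Qed.

(** Density provides a finite combination at squared distance less than [d]; the projection onto the
    same indices is at least as close, and its squared error is the norm minus the sum. Only finite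
    sums are involved. *)
Lemma parseval_lower (I : choiceType) (L : set I) (e : I -> R -> C) (f : R -> C) (d : R) :
  (forall i, bcsC (e i)) -> bcsC f -> orthonormal_basis setT L e -> 0 < d ->
  exists s : seq I, [/\ uniq s, forall i, i \in s -> L i &
    complex.Re (ip f f) - d <= \sum_(i <- s) sqnorm (ip f (e i))].
Proof.
move=> be bf [[_ on] dense] d0.
have [r [c [rL]]] := dense f (memL2_bcs bf) d d0.
set g := (fun x => _); have bg : bcsC g.
  by apply: bcsCB => //; apply: bcsC_sum => i; exact: bcsCZ.
rewrite norm2sq_inner// lte_fin => gd.
exists (undup r); split; first exact: undup_uniq.
  by move=> i; rewrite mem_undup; exact: rL.
have rs : {subset r <= undup r} by move=> i; rewrite mem_undup.
have on' : forall i j, i \in undup r -> j \in undup r -> ip (e i) (e j) = (i == j)%:R.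
  by move=> i j; rewrite !mem_undup => /rL Li /rL Lj; exact: on.
have h : complex.Re (ip f f) - \sum_(i <- undup r) sqnorm (ip f (e i)) <= complex.Re (ip g g).
  exact: (best_approximation be (undup_uniq r) on' bf c rs).
by rewrite lerBlDr -lerBlDl (le_trans h)// ltW.
Qed.

End Parseval.

(** * Inner products of Gabor functions with boxes *)

Section GaborBoxes.
Context {R : realType}.
Local Notation C := (complex R).
Local Notation ip := (@inner R setT).
Variables alpha beta : R.
Hypotheses (alpha0 : 0 < alpha) (alpha2 : alpha < 1 / 2) (beta0 : 0 < beta).

Local Notation gab := (gabor (chi (two_intervals alpha beta))).

Lemma gabor_box (t nu : R) x : gab (t, nu) x =
  box t (t + alpha) nu x + box (t + alpha + beta) (t + 1 + beta) nu x.
Proof.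
rewrite /gabor /= /box -mulrDl; congr (_ * _); rewrite /chi; apply: complex_ext; last by rewrite /= addr0.
rewrite /= /two_intervals !indicE in_setU !mem_setE !in_itv/=.
have -> : (0 <= x - t) = (t <= x) by apply/idP/idP => ?; lra.
have -> : (x - t < alpha) = (x < t + alpha) by apply/idP/idP => ?; lra.
have -> : (alpha + beta <= x - t) = (t + alpha + beta <= x) by apply/idP/idP => ?; lra.
have -> : (x - t < 1 + beta) = (x < t + 1 + beta) by apply/idP/idP => ?; lra.
case: (boolP (x < t + alpha)) => h1.
  have -> : (t + alpha + beta <= x) = false.
    by apply/negbTE; rewrite -ltNge; move: beta0 h1; lra.
  by rewrite /= addr0 andbT orbF.
by rewrite andbF /= add0r.
Qed.

Lemma bcsC_gabor l : bcsC (gab l).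
Proof.
case: l => t nu; apply: bcsC_ext (bcsCD (bcsC_box _ _ _) (bcsC_box _ _ _)) _ => x.
by rewrite gabor_box.
Qed.

Lemma inner_box_gabor a b m t nu : ip (box a b m) (gab (t, nu)) =
  expint (Num.max a t) (Num.min b (t + alpha)) (m - nu) +
  expint (Num.max a (t + alpha + beta)) (Num.min b (t + 1 + beta)) (m - nu).
Proof.
rewrite (_ : gab (t, nu) = (fun x => box t (t + alpha) nu x +
   box (t + alpha + beta) (t + 1 + beta) nu x)); last by apply/funext => x; exact: gabor_box.
by rewrite innerDr ?inner_box//; exact: bcsC_box.
Qed.

Lemma inner_gabor t nu t' nu' : ip (gab (t, nu)) (gab (t', nu')) =
  expint (Num.max t t') (Num.min (t + alpha) (t' + alpha)) (nu - nu') +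
  expint (Num.max t (t' + alpha + beta)) (Num.min (t + alpha) (t' + 1 + beta)) (nu - nu') +
  (expint (Num.max (t + alpha + beta) t') (Num.min (t + 1 + beta) (t' + alpha)) (nu - nu') +
  expint (Num.max (t + alpha + beta) (t' + alpha + beta)) (Num.min (t + 1 + beta) (t' + 1 + beta)) (nu - nu')).
Proof.
rewrite (_ : gab (t, nu) = (fun x => box t (t + alpha) nu x +
   box (t + alpha + beta) (t + 1 + beta) nu x)); last by apply/funext => x; exact: gabor_box.
rewrite innerDl ?inner_box_gabor//; try exact: bcsC_box.
exact: bcsC_gabor.
Qed.

Lemma expint_shift a b m c : expint (a + c) (b + c) m = expi (2 * pi * m * c) * expint a b m :> C.
Proof.
rewrite /expint ltrD2r; case: ifPn => ab; last by rewrite mulr0.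
have [->|m0] := eqVneq m 0.
  by rewrite mulr0 mul0r /expi cos0 sin0; apply: complex_ext; rewrite ?ReM ?ImM /=; ring.
have : 2 * pi * m != 0 by rewrite !mulf_neq0// gt_eqF ?pi_gt0.
rewrite /expi; move: (2 * pi * m) => k k0.
by apply: complex_ext; rewrite ?ReM ?ImM /= !mulrDr ?cosD ?sinD; field.
Qed.

Definition Psi (u : R * R) : R := sqnorm (ip (box 0 1 0) (gab u)).

Lemma Psi_ge0 u : 0 <= Psi u. Proof. exact: sqnorm_ge0. Qed.

(** Covariance: a joint time-frequency shift multiplies the inner product by a phase, which [sqnorm]
    discards. *)
Lemma sqnorm_inner_box (z l : R * R) :
  sqnorm (ip (box z.1 (z.1 + 1) z.2) (gab l)) = Psi (l.1 - z.1, l.2 - z.2).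
Proof.
case: z l => [z1 z2] [t nu] /=; rewrite /Psi !inner_box_gabor.
have E a b c d : Num.max a b = Num.max (a - z1) (b - z1) + z1 /\
  Num.min c d = Num.min (c - z1) (d - z1) + z1.
  by rewrite addr_maxl addr_minl !subrK.
rewrite [Num.max z1 t](E _ _ 0 0).1 [Num.max z1 (t + _ + _)](E _ _ 0 0).1.
rewrite [Num.min _ (t + alpha)](E 0 0 _ _).2 [Num.min _ (t + 1 + _)](E 0 0 _ _).2.
rewrite !expint_shift -mulrDr sqnormM sqnorm_expi mul1r.
congr (sqnorm (expint (Num.max _ _) (Num.min _ _) _ + expint (Num.max _ _) (Num.min _ _) _)); ring.
Qed.

Lemma inner_unit_box (a m : R) : ip (box a (a + 1) m) (box a (a + 1) m) = 1.
Proof. by rewrite inner_box subrr maxxx minxx /expint eqxx ltrDl ltr01 addrAC subrr add0r. Qed.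

Lemma Psi_parseval (Lambda : set (R * R)) (z : R * R) (d : R) :
  gabor_onb (chi (two_intervals alpha beta)) Lambda -> 0 < d ->
  exists s : seq (R * R), [/\ uniq s, forall l, l \in s -> Lambda l &
    1 - d <= \sum_(l <- s) Psi (l.1 - z.1, l.2 - z.2)].
Proof.
move=> onb d0.
have [s [us sL H]] := parseval_lower bcsC_gabor (bcsC_box z.1 (z.1 + 1) z.2) onb d0.
exists s; split => //; move: H; rewrite inner_unit_box.
by under eq_bigr do rewrite sqnorm_inner_box.
Qed.

End GaborBoxes.

(** * The integral of Psi *)

Section PsiIntegral.
Context {R : realType}.
Local Notation mu := (@lebesgue_measure R).
Local Notation C := (complex R).
Local Notation ip := (@inner R setT).
Variables alpha beta : R.
Hypotheses (alpha0 : 0 < alpha) (alpha2 : alpha < 1 / 2) (beta0 : 0 < beta).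

Local Notation gab := (gabor (chi (two_intervals alpha beta))).
Local Notation Psi := (@Psi R alpha beta).

(** The indicator of the intersection of [[0, 1)] with [Omega + u.1]. It takes the whole pair [u] so
    as to share its domain with the phase factor. *)
Let ov (u : R * R) (x : R) : R :=
  \1_(`[0, 1[%classic) x * \1_(two_intervals alpha beta) (x - u.1).

Let ov_ge0 u x : 0 <= ov u x.
Proof. by rewrite mulr_ge0. Qed.

Let inner_ov u : ip (box 0 1 0) (gab u) =
  Complex (Rintegral mu setT (fun x => ov u x * cos (2 * pi * u.2 * x)))
          (- Rintegral mu setT (fun x => ov u x * sin (2 * pi * u.2 * x))).
Proof.
have bg : bcsC (fun x => box 0 1 0 x * conjc (gab u x)).
  by apply: bcsCM (bcsC_box _ _ _) (bcsCJ (bcsC_gabor _ _ _)).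
have E x : box 0 1 0 x * conjc (gab u x) =
  Complex (ov u x * cos (2 * pi * u.2 * x)) (- (ov u x * sin (2 * pi * u.2 * x))).
  rewrite /gabor /character /expi /chi boxE mulr0 mul0r cos0 sin0 /ov.
  by apply: complex_ext; rewrite ?ReM ?ImM ?ReJ ?ImJ /=; ring.
rewrite /inner /cintegral; congr Complex.
  by apply: eq_Rintegral => x _; rewrite E.
rewrite -[RHS]mulN1r -RintegralZl//; last first.
  case: bg => _ /bcsN b2; apply: bcs_integrable.
  by apply: bcs_ext b2 _ => x; rewrite E /= opprK.
by apply: eq_Rintegral => x _; rewrite E mulN1r.
Qed.

Let measurable_ov : measurable_fun [set: (R * R) * R] (fun p => ov p.1 p.2).
Proof.
apply: measurable_funM.
  by apply: (measurableT_comp (measurable_indic (measurable_itv _))); exact: measurable_snd.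
apply: (measurableT_comp (measurable_indic (measurableU _ _ (measurable_itv _) (measurable_itv _)))).
apply: measurable_funB; first exact: measurable_snd.
exact: measurableT_comp measurable_fst measurable_fst.
Qed.

Let measurable_phase : measurable_fun [set: (R * R) * R] (fun p => 2 * pi * p.1.2 * p.2).
Proof.
apply: measurable_funM; last exact: measurable_snd.
apply: measurable_funM; first exact: measurable_cst.
exact: measurableT_comp measurable_snd measurable_fst.
Qed.

Let measurable_two : measurable (two_intervals alpha beta).
Proof. exact: measurableU. Qed.

Let bcs_ov_trig u (f : R -> R) : continuous f -> (forall x, `|f x| <= 1) ->
  bcs (fun x => ov u x * f (2 * pi * u.2 * x)).
Proof.
move=> cf f1; exists 1; split.
- apply: measurable_funM; first exact: measurableT_comp measurable_ov (measurable_pair1 u).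
  apply: measurableT_comp (continuous_measurable_fun cf) _.
  exact: measurableT_comp measurable_phase (measurable_pair1 u).
- move=> x; rewrite normrM -[leRHS]mulr1; apply: ler_pM => //.
  by rewrite /ov !indicE; do 2 case: (_ \in _); rewrite /= ?mulr0 ?mul0r ?mulr1 ?normr0 ?normr1.
- move=> x x1; rewrite /ov [\1_(`[0, 1[%classic) x]indicE memNset ?mul0r//= in_itv/=.
  by move=> /andP[x0 /ltW x2]; move: x1; rewrite ltNge ger0_norm// x2.
Qed.

Let measurable_Rint (h : (R * R) * R -> R) : measurable_fun setT h -> (forall p, 0 <= h p) ->
  measurable_fun [set: R * R] (fun u => Rintegral mu setT (fun x => h (u, x))).
Proof.
move=> mh h0; apply: measurableT_comp (fine_measurable measurableT) _.
apply: (@measurable_fun_fubini_tonelli_F _ _ _ _ _ mu (fun p => (h p)%:E)) => //.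
exact/measurable_EFinP.
Qed.

(** Tonelli's measurability result is for nonnegative integrands: adding 1 makes the trigonometric
    factor nonnegative, and the integral of [ov] is subtracted afterwards. *)
Let measurable_ov_trig (f : R -> R) : continuous f -> (forall x, `|f x| <= 1) ->
  measurable_fun [set: R * R] (fun u => Rintegral mu setT (fun x => ov u x * f (2 * pi * u.2 * x))).
Proof.
move=> cf f1.
have mf : measurable_fun [set: (R * R) * R] (fun p => f (2 * pi * p.1.2 * p.2)).
  exact: measurableT_comp (continuous_measurable_fun cf) measurable_phase.
have -> : (fun u => Rintegral mu setT (fun x => ov u x * f (2 * pi * u.2 * x))) =
  (fun u => Rintegral mu setT (fun x => ov u x * (1 + f (2 * pi * u.2 * x))) -
            Rintegral mu setT (fun x => ov u x)).
  apply/funext => u.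
  have b1 : bcs (fun x => ov u x).
    apply: bcs_ext (bcs_ov_trig u (@cst_continuous _ _ (1 : R)) _) _ => x; last by rewrite mulr1.
    by rewrite normr1.
  have b2 := bcs_ov_trig u cf f1.
  rewrite -RintegralB//; try exact: bcs_integrable.
    by apply: eq_Rintegral => x _; ring.
  apply: bcs_integrable; apply: bcs_ext (bcsD b1 b2) _ => x /=; ring.
apply: measurable_funB.
  apply: (measurable_Rint (h := fun p => ov p.1 p.2 * (1 + f (2 * pi * p.1.2 * p.2)))).
    apply: measurable_funM => //; exact: measurable_funD.
  move=> p; apply: mulr_ge0 => //; have := f1 (2 * pi * p.1.2 * p.2).
  by rewrite ler_norml => /andP[]; lra.
exact: (measurable_Rint (h := fun p => ov p.1 p.2)).
Qed.

Lemma measurable_Psi : measurable_fun [set: R * R] Psi.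
Proof.
rewrite (_ : (Psi : _ -> _) = fun u =>
  Rintegral mu setT (fun x => ov u x * cos (2 * pi * u.2 * x)) ^+ 2 +
  Rintegral mu setT (fun x => ov u x * sin (2 * pi * u.2 * x)) ^+ 2); last first.
  by apply/funext => u; rewrite /Psi inner_ov /sqnorm /= sqrrN.
apply: measurable_funD; apply: measurable_funX; apply: measurable_ov_trig.
- exact: continuous_cos.
- exact: cos_max.
- exact: continuous_sin.
- exact: sin_max.
Qed.

(** The length of the intersection of [[0, 1)] with [Omega + t]. *)
Let A (t : R) : R := complex.Re (ip (box 0 1 0) (gab (t, 0))).

Let inner_box01 (k l : nat) (c : R) :
  ip (box 0 1 (c + k%:R)) (box 0 1 (c + l%:R)) = (k == l)%:R.
Proof.
rewrite inner_box maxxx minxx /expint ltr01.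
have -> : c + k%:R - (c + l%:R) = k%:R - l%:R by ring.
rewrite subr_eq0 eqr_nat; case: eqVneq => [_|kl]; first by rewrite subr0.
have sN (n : nat) : sin (2 * pi * n%:R) = 0 :> R /\ cos (2 * pi * n%:R) = 1 :> R.
  have -> : 2 * pi * n%:R = 0 + (pi *+ 2) *+ n :> R by rewrite -mulr_natr -[pi *+ 2]mulr_natr; ring.
  by rewrite (periodicn (@sinD2pi R)) (periodicn (@cosD2pi R)) sin0 cos0.
by rewrite mulr1 mulr0 mulrBr sinB cosB sin0 cos0 !(sN _).1 !(sN _).2 !mulr0 !mul0r !mulr1 !subrr !mul0r addr0 subrr mul0r.
Qed.

(* Bessel's inequality for the exponentials of frequencies [c + k] on [0, 1). *)
Let Psi_bessel (t c : R) (n : nat) : \sum_(0 <= k < n) Psi (t, c + k%:R) <= A t.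
Proof.
(* [f] is the indicator of the overlap: its coefficients on the exponentials are the inner products
   inside [Psi], and its squared norm is [A t]. *)
pose f x := box 0 1 0 x * conjc (gab (t, 0) x).
have bf : bcsC f by apply: bcsCM (bcsC_box _ _ _) (bcsCJ (bcsC_gabor _ _ _)).
pose e (k : nat) := box 0 1 (c + k%:R) : R -> C.
have on i j : i \in iota 0 n -> j \in iota 0 n -> ip (e i) (e j) = (i == j)%:R.
  by move=> _ _; exact: inner_box01.
have := bessel (fun k => bcsC_box _ _ _) (iota_uniq 0 n) on bf.
have -> : complex.Re (ip f f) = A t.
  congr complex.Re; rewrite /inner; congr cintegral; apply/funext => x.
  rewrite /f /gabor /character /expi /chi boxE /=.
  rewrite !(mulr0, mul0r) cos0 sin0 !indicE.
  by do 2 case: (_ \in _); apply: complex_ext; rewrite ?ReM ?ImM ?ReJ ?ImJ /=; ring.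
rewrite /index_iota subn0; apply: le_trans; apply: ler_sum => k _; rewrite /Psi.
rewrite le_eqVlt; apply/orP; left; apply/eqP; congr sqnorm.
rewrite /inner; congr cintegral; apply/funext => x.
rewrite /f /e /gabor /character !boxE /expi /chi /= !(mulr0, mul0r) cos0 sin0 !indicE.
by do 2 case: (_ \in _); apply: complex_ext; rewrite ?ReM ?ImM ?ReJ ?ImJ /=; ring.
Qed.

Local Open Scope ereal_scope.

Let mPsi (t c : R) : measurable_fun [set: R] (fun y : R => (Psi (t, (y + c)%R))%:E).
Proof.
apply/measurable_EFinP; apply: measurableT_comp measurable_Psi _.
apply/measurable_fun_pairP; split; first exact: measurable_cst.
exact: measurable_addr.
Qed.

(** Folds a slab onto a unit interval, where the sum over integer shifts can be bounded pointwise by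
    [Psi_bessel]. *)
Let integral_slab (f : R -> \bar R) (c : R) (n : nat) : measurable_fun setT f ->
  (forall x, 0 <= f x) ->
  \int[mu]_(y in `[c, (c + n%:R)%R[) f y =
  \int[mu]_(y in `[c, (c + 1)%R[) \sum_(0 <= k < n) f (y + k%:R)%R.
Proof.
move=> mf f0; have mfs k : measurable_fun setT (fun y : R => f (y + k)%R).
  exact: measurableT_comp mf (measurable_addr k).
rewrite ge0_integral_sum//; last by move=> k; exact: measurable_funS (mfs _).
elim: n => [|n ih].
  by rewrite addr0 big_geq// set_itv_ge ?integral_set0// bnd_simp ltxx.
rewrite big_nat_recr//= -ih.
have -> : `[c, (c + n.+1%:R)%R[%classic = `[c, (c + n%:R)%R[ `|` `[(c + n%:R)%R, (c + n.+1%:R)%R[ :> set R.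
  have := ler0n R n; rewrite -natr1 => n0; apply/seteqP; split => x /=; rewrite !in_itv/=.
    by move=> /andP[h1 h2]; case: (ltP x (c + n%:R)%R) => h3; [left|right]; rewrite ?h1.
  by move=> [|] /andP[h1 h2]; apply/andP; split; lra.
rewrite ge0_integral_setU//; last 2 first.
  by apply: measurable_funS mf.
  apply/disj_setPS => x /=; rewrite !in_itv/= => -[/andP[_ h1] /andP[h2 _]].
  by move: h1; rewrite ltNge h2.
congr (_ + _).
rewrite [RHS]integral_mkcond [LHS]integral_mkcond.
rewrite -(@ge0_integral_shift _ n%:R (f \_ _)).
- apply: eq_integral => x _; rewrite !patchE.
  congr (if _ then _ else _); rewrite !mem_setE !in_itv/= -natr1.
  by apply/idP/idP => /andP[h1 h2]; apply/andP; split; lra.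
- by apply/(measurable_restrictT f) => //; exact: measurable_funS mf.
- by move=> x; exact: erestrict_ge0.
Qed.

Let integral_Psi_freq t : \int[mu]_y (Psi (t, y))%:E <= (A t)%:E.
Proof.
have mf : measurable_fun [set: R] (fun y : R => (Psi (t, y))%:E).
  have := mPsi t 0; congr measurable_fun; apply/funext => y; by rewrite addr0.
have P0 y : 0 <= (Psi (t, y))%:E by rewrite lee_fin Psi_ge0.
have slab (N : nat) : \int[mu]_(y in `[(- N%:R)%R, N%:R[) (Psi (t, y))%:E <= (A t)%:E.
  rewrite [X in `[_, X[](_ : N%:R = (- N%:R + (N + N)%:R)%R :> R); last by rewrite natrD; ring.
  rewrite (@integral_slab (fun y => (Psi (t, y))%:E))//.
  apply: (@le_trans _ _ (\int[mu]_(y in `[(- N%:R)%R, (- N%:R + 1)%R[) (A t)%:E)).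
    apply: ge0_le_integral => //.
    - by move=> y _; apply: sume_ge0.
    - apply: emeasurable_sum => k; exact: measurable_funS (mPsi t k%:R).
    - by move=> y _; rewrite sumEFin lee_fin; exact: Psi_bessel.
  rewrite integral_cst//=; set m := mu _.
  have -> : m = 1 by rewrite /m lebesgue_measure_itv/= lte_fin ltrDl ltr01 -EFinB; congr EFin; ring.
  by rewrite mule1.
have T : [set: R] = \bigcup_N `[(- N%:R)%R, N%:R[%classic.
  apply/seteqP; split => // x _; exists (Num.truncn `|x|).+1 => //=; rewrite in_itv/=.
  have := truncnS_gt `|x|; rewrite ltr_norml => /andP[h1 h2].
  by rewrite (ltW h1).
rewrite T.
apply: cvge_to_le (ge0_nondecreasing_set_cvg_integral _ _ _ _) _.
- move=> m n mn; rewrite subsetEset => x /=; rewrite !in_itv/= => /andP[h1 h2].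
  have : (m%:R <= n%:R :> R)%R by rewrite ler_nat.
  by move=> h3; apply/andP; split; lra.
- by move=> n.
- by move=> n; exact: measurable_funS mf.
- by move=> n x _.
- by apply: nearW => n; exact: slab.
Qed.

Let A_integral t : (A t)%:E = \int[mu]_x (ov (t, 0%R) x)%:E.
Proof.
have b := bcs_ov_trig (t, 0%R) (@continuous_cos R) (@cos_max R).
rewrite /A inner_ov /= /Rintegral fineK; last exact: (integrable_fin_num _ (bcs_integrable b)).
by apply: eq_integral => x _; rewrite mulr0 mul0r cos0 mulr1.
Qed.

(** The variable runs over the reflected set [x - Omega], whose intervals are open on the left;
    their lengths [alpha] and [1 - alpha] add up to 1. *)
Let integral_reflect x : \int[mu]_t (\1_(two_intervals alpha beta) (x - t)%R)%:E = 1.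
Proof.
have E : (fun t => \1_(two_intervals alpha beta) (x - t)%R) =
   \1_(`](x - alpha)%R, x] `|` `](x - (1 + beta))%R, (x - (alpha + beta))%R]) :> (R -> R).
  apply/funext => t; rewrite !indicE !in_setU !mem_setE !in_itv/=; congr ((_ || _)%:R).
    by apply/idP/idP => /andP[h1 h2]; apply/andP; split; lra.
  by apply/idP/idP => /andP[h1 h2]; apply/andP; split; lra.
rewrite (_ : (fun t => _) = (fun t => (\1_(`](x - alpha)%R, x] `|` `](x - (1 + beta))%R, (x - (alpha + beta))%R]) t)%:E)); last first.
  by apply/funext => t; rewrite -E.
rewrite integral_indic//; last exact: measurableU.
rewrite setIT measureU//.
  rewrite /= !lebesgue_measure_itv/= !lte_fin.
  have -> : (x - alpha < x)%R by move: alpha0; lra.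
  have -> : (x - (1 + beta) < x - (alpha + beta))%R by move: alpha2; lra.
  by rewrite -!EFinB -EFinD; congr EFin; ring.
apply/seteqP; split => // t /=; rewrite !in_itv/= => -[/andP[h1 _] /andP[_ h2]].
by exfalso; move: beta0 h1 h2; lra.
Qed.

(** Integrating first in frequency leaves at most the integral of [A]; by Tonelli this is the
    integral over [x] in [[0, 1)] of the measure of [x - Omega], which is 1. *)
Lemma integral_Psi : \int[mu \x mu]_u (Psi u)%:E <= 1.
Proof.
have m1 : measurable_fun setT (fun u => (Psi u)%:E) by apply/measurable_EFinP; exact: measurable_Psi.
rewrite fubini_tonelli1//; last by move=> u; rewrite lee_fin Psi_ge0.
pose f (p : R * R) := (ov (p.1, 0%R) p.2)%:E.
have mf : measurable_fun setT f.
  have h : measurable_fun [set: R * R] (fun p : R * R => ((p.1, 0%R : R), p.2)).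
    apply/measurable_fun_pairP; split; last exact: measurable_snd.
    by apply/measurable_fun_pairP; split; [exact: measurable_fst|exact: measurable_cst].
  by apply/measurable_EFinP; exact: measurableT_comp measurable_ov h.
have f0 p : 0 <= f p by rewrite lee_fin.
have mA : measurable_fun [set: R] (fun t => (A t)%:E).
  rewrite (_ : (fun t => _) = fubini_F mu f); last by apply/funext => t; rewrite A_integral.
  exact: measurable_fun_fubini_tonelli_F.
apply: (@le_trans _ _ (\int[mu]_t (A t)%:E)).
  apply: ge0_le_integral => //.
  - by move=> t _; apply: integral_ge0 => y _; rewrite lee_fin Psi_ge0.
  - apply: measurable_fun_fubini_tonelli_F => //.
    by move=> u; rewrite lee_fin Psi_ge0.
  - by move=> t _; exact: integral_Psi_freq.
under eq_integral do rewrite A_integral.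
rewrite -[leLHS]/(\int[mu]_t fubini_F mu f t) -fubini_tonelli1// fubini_tonelli2// /fubini_G /f /=.
have -> : (fun y : R => \int[mu]_x (ov (x, 0%R) y)%:E) = (fun y : R => (\1_(`[0%R, 1%R[%classic) y)%:E).
  apply/funext => x; rewrite /ov /=.
  under eq_integral do rewrite EFinM.
  rewrite ge0_integralZl// ?integral_reflect ?mule1//.
  have h : measurable_fun [set: R] (fun y : R => (x - y)%R).
    by apply: measurable_funB; [exact: measurable_cst|exact: measurable_id].
  by apply/measurable_EFinP; exact: measurableT_comp (measurable_indic measurable_two) h.
rewrite integral_indic// setIT /= lebesgue_measure_itv/= lte_fin ltr01 -EFinB subr0.
by [].
Qed.

End PsiIntegral.

(** * Packing bound *)

Section PackingBound.
Context {R : realType}.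
Local Notation mu := (@lebesgue_measure R).
Local Notation mu2 := (mu \x mu)%E.
Variables (P : R * R -> R) (Lambda : set (R * R)) (D B : set (R * R)) (w : R * R).
Hypotheses (P0 : forall u, 0 <= P u) (mP : measurable_fun setT P).
Hypothesis P_int : (\int[mu2]_u (P u)%:E <= 1)%E.
Hypothesis P_frame : forall (z : R * R) (d : R), 0 < d ->
  exists s : seq (R * R), [/\ uniq s, forall l, l \in s -> Lambda l &
    1 - d <= \sum_(l <- s) P (l.1 - z.1, l.2 - z.2)].
Hypothesis cLambda : countable Lambda.
Hypotheses (mD : measurable D) (mB : measurable B).
Hypothesis D_disj : forall l l' u, Lambda l -> Lambda l' ->
  D (u.1 - l.1, u.2 - l.2) -> D (u.1 - l'.1, u.2 - l'.2) -> l = l'.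
Hypothesis B_disj : forall u l, B u -> Lambda l ->
  ~ D (u.1 + w.1 - l.1, u.2 + w.2 - l.2).

(** The value [None] lets one sequence enumerate a finite or an infinite [Lambda], each point once,
    so that sums over [Lambda] become series that commute with integrals. The function [f] returns
    the index of a point. *)
Let enum_Lambda : exists lam : nat -> option (R * R),
  (forall k l, lam k = Some l -> Lambda l) /\
  exists f : R * R -> nat, (forall l, Lambda l -> lam (f l) = Some l) /\
    (forall k l, lam k = Some l -> f l = k).
Proof.
have /countable_injP[f finj] := cLambda.
pose lam k := if pselect (exists l, Lambda l /\ f l = k) is left H
  then Some (projT1 (cid H)) else None.
have lamE k l : lam k = Some l -> Lambda l /\ f l = k.
  by rewrite /lam; case: pselect => // H [<-]; case: cid.
exists lam; split; first by move=> k l /lamE[].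
exists f; split; last by move=> k l /lamE[].
move=> l Ll; rewrite /lam; case: pselect => [H|[]]; last by exists l.
case: cid => /= l' [Ll' fl']; congr Some; apply: finj => //; exact/mem_set.
Qed.

Local Open Scope ereal_scope.

(** The sum of [P (v + l - w)] over [Lambda] is at least 1 for each [v]. Integrated over [D] it
    becomes the integral of [P] over the sets [D + l - w], which are disjoint and avoid [B]. The
    offset [w] moves the hole [B + w] to [B], a place where the integral of [P] can be evaluated. *)
Lemma packing_bound : mu2 D + \int[mu2]_(u in B) (P u)%:E <= 1.
Proof.
have [lam [lamL [f [lamf flam]]]] := enum_Lambda.
pose T k (v : R * R) : \bar R := if lam k is Some l then
  (P (v.1 + (l.1 - w.1), v.2 + (l.2 - w.2))%R)%:E else 0.
pose G k (u : R * R) : \bar R := if lam k is Some l then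
  (\1_D (u.1 - (l.1 - w.1), u.2 - (l.2 - w.2))%R)%:E * (P u)%:E else 0.
have mshift c : measurable_fun [set: R * R] (fun u : R * R => (u.1 + c.1, u.2 + c.2)%R).
  apply/measurable_fun_pairP; split.
    exact: (measurable_funD measurable_fst (@measurable_cst _ _ _ _ _ c.1)).
  exact: (measurable_funD measurable_snd (@measurable_cst _ _ _ _ _ c.2)).
have mPE : measurable_fun setT (fun u => (P u)%:E) by exact/measurable_EFinP.
have mT k : measurable_fun setT (T k).
  rewrite /T; case: (lam k) => [l|]; last exact: measurable_cst.
  exact: measurableT_comp mPE (mshift (l.1 - w.1, l.2 - w.2)%R).
have T0 k v : 0 <= T k v.
  by rewrite /T; case: (lam k) => [l|] //; rewrite lee_fin.
have mH (l : R * R) : measurable_fun setT (fun u : R * R =>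
    (\1_D (u.1 - (l.1 - w.1), u.2 - (l.2 - w.2))%R)%:E * (P u)%:E).
  apply: emeasurable_funM => //; apply/measurable_EFinP.
  exact: measurableT_comp (measurable_indic mD) (mshift (- (l.1 - w.1), - (l.2 - w.2))%R).
have mG k : measurable_fun setT (G k).
  by rewrite /G; case: (lam k) => [l|]; [exact: mH|exact: measurable_cst].
have G0 k v : 0 <= G k v.
  by rewrite /G; case: (lam k) => [l|] //; rewrite mule_ge0// lee_fin.
have T_ge1 v : 1 <= \sum_(k <oo) T k v.
  apply/lee_subgt0Pr => d d0.
  (* At [z = w - v] the summand is [P (v + l - w)]; a finite partial sum bounds the nonnegative
     series from below. *)
  have [s [us sL]] := @P_frame (w.1 - v.1, w.2 - v.2)%R d d0.
  rewrite -EFinB -lee_fin => /le_trans; apply.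
  rewrite nneseries_esumT//; apply: esum_ge.
  exists [set` map f s]; first by split => //; exact: finite_seq.
  rewrite -fsbig_seq; last first.
    rewrite map_inj_in_uniq// => l l' /sL Ll /sL Ll' ff.
    by have := lamf _ Ll; rewrite ff lamf// => -[].
  rewrite big_map -sumEFin big_seq [leRHS]big_seq; apply: lee_sum => l /sL Ll.
  rewrite /T lamf// lee_fin le_eqVlt; apply/orP; left; apply/eqP; congr P.
  by congr pair => /=; ring.
(* Termwise substitution [u = v + l - w]. *)
have TG : \int[mu2]_(v in D) (\sum_(k <oo) T k v) = \int[mu2]_u \sum_(k <oo) G k u.
  rewrite !integral_nneseries//; last by move=> k; exact: measurable_funS (mT k).
  apply: eq_eseriesr => k _; rewrite integral_mkcond /T /G.
  case: (lam k) => [l|]; last first.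
    by rewrite (_ : (fun=> 0) \_ D = cst 0)//; apply/funext => x; rewrite patchE; case: ifP.
  pose h (u : R * R) := (\1_D (u.1 - (l.1 - w.1), u.2 - (l.2 - w.2))%R)%:E * (P u)%:E.
  rewrite -[RHS]/(\int[mu2]_u h u) -(ge0_integral_shift2 (l.1 - w.1, l.2 - w.2)%R).
  - apply: eq_integral => v _; rewrite patchE /h /= !addrK -surjective_pairing indicE.
    by case: (v \in D); rewrite ?mul1e ?mul0e.
  - exact: mH.
  - by move=> u; rewrite mule_ge0// lee_fin.
(* By disjointness at most one term is nonzero, and on [B] none is; a surviving term equals
   [P u]. *)
have G_le u : \sum_(k <oo) G k u <= ((fun u => (P u)%:E) \_ (~` B)) u.
  have PB0 : 0 <= ((fun u => (P u)%:E) \_ (~` B)) u by rewrite patchE; case: ifP => // _; rewrite lee_fin.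
  have [[k Gk]|Gk] := pselect (exists k, G k u != 0); last first.
    by rewrite eseries0// => k _ _; apply/eqP; apply: contra_notT Gk => Gk; exists k.
  rewrite (@nneseriesD1 _ _ k)//.
  have GD j : G j u != 0 -> exists l, [/\ lam j = Some l, Lambda l &
    D (u.1 + w.1 - l.1, u.2 + w.2 - l.2)%R].
    rewrite /G; case E : (lam j) => [l|]; last by rewrite eqxx.
    rewrite indicE; case: (boolP (_ \in D)); last by rewrite mul0e eqxx.
    rewrite inE => Dl _; exists l; split => //; first exact: lamL E.
    by move: Dl; congr D; congr pair; ring.
  have [l [El Ll Dl]] := GD k Gk.
  rewrite eseries0 ?adde0; last first.
    move=> j _ jk; apply/eqP; apply: contraTT jk => /GD[l' [El' Ll' Dl']].
    rewrite negbK -(flam _ _ El) -(flam _ _ El'); apply/eqP; congr f.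
    exact: (@D_disj l' l (u.1 + w.1, u.2 + w.2)%R).
  rewrite patchE mem_set; last by move=> Bu; exact: (B_disj Bu Ll).
  by rewrite /G El indicE; case: (_ \in D); rewrite ?mul1e ?mul0e// lee_fin P0.
suff le1 : mu2 D <= \int[mu2]_(u in ~` B) (P u)%:E.
  apply: le_trans (leeD2r _ le1) _.
  rewrite -ge0_integral_setU//; first by rewrite setvU.
  - exact: measurableC.
  - by rewrite setvU.
  - by move=> u _; rewrite lee_fin.
  - by apply/disj_setPS => u [].
apply: (@le_trans _ _ (\int[mu2]_(v in D) (\sum_(k <oo) T k v))).
  rewrite -[leLHS]mul1e -integral_cst//.
  apply: ge0_le_integral => //.
  by apply: measurable_funS (ge0_emeasurable_sum (fun k v _ _ => T0 k v) (fun k _ => mT k)).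
rewrite TG [leRHS]integral_mkcond; apply: ge0_le_integral => //.
- by move=> u _; exact: nneseries_ge0.
- exact: (ge0_emeasurable_sum (fun k v _ _ => G0 k v) (fun k _ => mG k)).
- by apply/(measurable_restrictT _ (measurableC mB)); exact: measurable_funS mPE.
Qed.

End PackingBound.

(** * Zeros of the Fourier transforms of overlaps *)

Section Nonvanishing.
Context {R : realType}.
Local Notation C := (complex R).
Implicit Types a b m L d th : R.

Lemma cos_eq1 (y : R) : cos y = 1 -> `|y| < 2 * pi -> y = 0.
Proof.
move=> c1 y2; apply/eqP; apply: contraT => y0; exfalso.
have h : 0 < `|y| / 2 < pi.
  have : 0 < `|y| by rewrite normr_gt0.
  by move: y2; move: (`|y|) => z z1 z2; apply/andP; split; lra.
have := sin_gt0_pi h.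
have E0 : `|y| = (`|y| / 2) *+ 2 by rewrite -mulr_natr divfK ?pnatr_eq0.
have := cos_mulr2n (`|y| / 2); rewrite -E0 cos_norm c1 cos2sin2 -mulr_natr => E.
have : sin (`|y| / 2) ^+ 2 = 0 by move: E; move: (sin _ ^+ 2) => z E; lra.
by move=> /eqP; rewrite sqrf_eq0 => /eqP ->; rewrite ltxx.
Qed.

Lemma cos_eqN1 (y : R) : cos y = -1 -> pi <= `|y|.
Proof.
move=> c1; rewrite leNgt; apply/negP => ylt.
have p0 := pi_gt0 R; case: (lerP 0 y) => y0.
  have : cos (y - pi) = 1 by rewrite cosB cospi sinpi c1; ring.
  move: ylt; rewrite ger0_norm// => ylt /cos_eq1 h.
  have : y - pi = 0 by apply: h; rewrite ltr_norml; apply/andP; split; lra.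
  by lra.
have : cos (y + pi) = 1 by rewrite cosD cospi sinpi c1; ring.
move: ylt; rewrite ltr0_norm// => ylt /cos_eq1 h.
have : y + pi = 0 by apply: h; rewrite ltr_norml; apply/andP; split; lra.
by lra.
Qed.

(** The bound on [x + y] excludes the supplementary solution [x = pi - y]: in the product formula
    for [sin x - sin y] the cosine factor is positive. *)
Lemma sin_eq_small (x y : R) : 0 < x -> 0 < y -> x + y < pi -> sin x = sin y -> x = y.
Proof.
move=> x0 y0 xy E; apply/eqP; apply: contraT => ne; exfalso.
have p0 := pi_gt0 R.
have E2 : cos ((x + y) / 2) * sin ((x - y) / 2) = 0.
  have E1 : sin ((x + y) / 2 + (x - y) / 2) = sin ((x + y) / 2 - (x - y) / 2).
    have -> : (x + y) / 2 + (x - y) / 2 = x by field.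
    by have -> : (x + y) / 2 - (x - y) / 2 = y by field.
  by move: E1; rewrite sinD sinB; move: (cos _ * sin _) (sin _ * cos _) => u v; lra.
have c0 : 0 < cos ((x + y) / 2) by apply: cos_gt0_pihalf; apply/andP; split; lra.
move: E2 => /eqP; rewrite mulf_eq0 (gt_eqF c0)/= => /eqP s0.
case: (ltrP x y) => xy'.
  have : 0 < sin ((y - x) / 2) by apply: sin_gt0_pi; apply/andP; split; lra.
  have -> : (y - x) / 2 = - ((x - y) / 2) by field.
  by rewrite sinN s0 oppr0 ltxx.
have : 0 < sin ((x - y) / 2) by apply: sin_gt0_pi; apply/andP; split; lra.
by rewrite s0 ltxx.
Qed.

(** The Fourier transform at [m] of the centred interval of length [L]. *)
Definition sinc L m : R := if m == 0 then L else sin (pi * m * L) / (pi * m).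

Lemma sinc_gt0 L m : 0 < L -> `|m| * L < 1 -> 0 < sinc L m.
Proof.
move=> L0 mL; rewrite /sinc; case: eqVneq => // m0.
have p0 := pi_gt0 R.
have -> : sin (pi * m * L) / (pi * m) = sin (pi * (`|m| * L)) / (pi * `|m|).
  case: (ltrP 0 m) => m1; first by rewrite gtr0_norm// !mulrA.
  by rewrite ler0_norm// !(mulNr, mulrN) sinN invrN mulrN mulNr opprK !mulrA.
have n0 : 0 < `|m| by rewrite normr_gt0.
apply: divr_gt0; last exact: mulr_gt0.
apply: sin_gt0_pi; rewrite !mulr_gt0//=.
by rewrite -[ltRHS]mulr1 ltr_pM2l.
Qed.

Lemma sinc_inj L L' m : 0 < L -> 0 < L' -> `|m| * (L + L') < 1 -> sinc L m = sinc L' m -> L = L'.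
Proof.
move=> L0 L'0 mL; rewrite /sinc; case: eqVneq => // m0.
have p0 := pi_gt0 R.
have n0 : 0 < `|m| by rewrite normr_gt0.
have k0 : pi * m != 0 by rewrite mulf_neq0// gt_eqF.
move=> /(mulIf (invr_neq0 k0)) E.
have E' : sin (pi * `|m| * L) = sin (pi * `|m| * L').
  case: (ltrP 0 m) => m1; first by rewrite gtr0_norm.
  by rewrite ler0_norm// !(mulNr, mulrN) !sinN E.
have k1 : 0 < pi * `|m| by rewrite mulr_gt0.
have /(mulfI (lt0r_neq0 k1)) : pi * `|m| * L = pi * `|m| * L'; last by [].
apply: sin_eq_small => //; try exact: mulr_gt0.
by rewrite -mulrDr -mulrA -[ltRHS]mulr1 ltr_pM2l.
Qed.

(** The length of the interval gives the real factor and its centre [(a + b) / 2] the phase. Where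
    [sinc] is positive this is the polar form. *)
Lemma expint_polar a b m : a < b ->
  expint a b m = Complex (sinc (b - a) m) 0 * expi (pi * m * (a + b)).
Proof.
move=> ab; rewrite /expint ab /sinc; case: eqVneq => [->|m0].
  by rewrite mulr0 mul0r /expi cos0 sin0; apply: complex_ext; rewrite ?ReM ?ImM /=; ring.
have -> : 2 * pi * m * b = pi * m * (a + b) + pi * m * (b - a) by ring.
have -> : 2 * pi * m * a = pi * m * (a + b) - pi * m * (b - a) by ring.
have : pi * m != 0 by rewrite mulf_neq0// gt_eqF// pi_gt0.
have -> : 2 * pi * m = 2 * (pi * m) by ring.
move: (pi * m) => k k0; rewrite /expi sinB sinD cosB cosD.
by apply: complex_ext; rewrite ?ReM ?ImM /=; field.
Qed.

Lemma polar_eq (s s' th th' : R) : 0 < s -> 0 < s' ->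
  Complex s 0 * expi th = Complex s' 0 * expi th' -> s = s' /\ cos (th - th') = 1.
Proof.
move=> s0 s'0 E.
have := congr1 sqnorm E; rewrite !sqnormM !sqnorm_expi !mulr1 /sqnorm /= expr0n /= !addr0.
move=> /eqP; rewrite eqrXn2// ?ltW// => /eqP E1; split => //.
have k0 : Complex s' 0 != 0 :> C by rewrite eq_complex /= (gt_eqF s'0).
move: E; rewrite E1 => /(mulfI k0) [c1 s1].
by rewrite cosB c1 s1 -!expr2 cos2Dsin2.
Qed.

Lemma expi_Dpi th : expi (th + pi) = - expi th :> C.
Proof. by rewrite /expi cosDpi sinDpi. Qed.

Lemma expint1_neq0 a b m : a < b -> `|m| * (b - a) < 1 -> expint a b m != 0.
Proof.
move=> ab mab; apply/eqP => /(congr1 sqnorm); rewrite expint_polar// sqnormM sqnorm_expi mulr1.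
have s0 : 0 < sinc (b - a) m by apply: sinc_gt0 => //; rewrite subr_gt0.
by rewrite /sqnorm /= expr0n /= !addr0 => /eqP; rewrite sqrf_eq0 (gt_eqF s0).
Qed.

(** Cancellation needs equal moduli, hence equal lengths by [sinc_inj], and opposite phases, hence
    centres at least half a period apart. For equal lengths the distance of the centres is that of
    the left endpoints. *)
Lemma expint2_eq0 a b a' b' m : a < b -> a' < b' ->
  `|m| * ((b - a) + (b' - a')) < 1 -> expint a b m + expint a' b' m = 0 ->
  b - a = b' - a' /\ 1 <= 2 * `|m| * `|a' - a|.
Proof.
move=> ab ab' mab /eqP; rewrite addr_eq0 => /eqP; rewrite !expint_polar//.
have L0 : 0 < b - a by rewrite subr_gt0.
have L0' : 0 < b' - a' by rewrite subr_gt0.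
have n0 := normr_ge0 m.
rewrite -mulrN -expi_Dpi => /polar_eq[||E cE].
- apply: sinc_gt0 => //; apply: le_lt_trans mab; apply: ler_wpM2l => //; lra.
- apply: sinc_gt0 => //; apply: le_lt_trans mab; apply: ler_wpM2l => //; lra.
have LL := sinc_inj L0 L0' mab E; split => //.
have : cos (pi * m * (a' + b') - pi * m * (a + b)) = -1.
  move: cE; rewrite opprD addrA cosB cospi sinpi mulr0 addr0 mulrN1.
  by rewrite -cosN opprB => cE; rewrite -[RHS]/(-1) -cE opprK.
have -> : pi * m * (a' + b') - pi * m * (a + b) = pi * (2 * m * (a' - a)).
  have -> : b' = b - a + a' by lra.
  by ring.
move=> /cos_eqN1; rewrite normrM (gtr0_norm (pi_gt0 R)) -{1}[pi]mulr1.
by rewrite ler_pM2l ?pi_gt0// !normrM (ger0_norm (ler0n _ 2)).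
Qed.

Lemma expintD a b c m : a <= b -> b <= c -> expint a b m + expint b c m = expint a c m.
Proof.
rewrite le_eqVlt => /predU1P[<- _|ab]; first by rewrite {1}/expint ltxx add0r.
rewrite le_eqVlt => /predU1P[<-|bc]; first by rewrite [X in _ + X]/expint ltxx addr0.
rewrite /expint ab bc (lt_trans ab bc); case: eqVneq => [_|m0].
  by apply: complex_ext; rewrite ?ReD ?ImD /=; ring.
by apply: complex_ext; rewrite ?ReD ?ImD /= -mulrDl; congr (_ / _); ring.
Qed.

Lemma expint_empty a b m : b <= a -> expint a b m = 0.
Proof. by rewrite /expint ltNge => ->. Qed.

(** The three pieces are [[d, 1 + be)] with two gaps of length [be] removed, so a zero means that
    the hull and the two gaps together have the same transform. Both are positive multiples of
    phases, whose angles differ by [pi * m * (1 - 2 * al)]; equality forces [m = 0]. Then lengths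
    give [1 + be - d = 2 * be], against [d + be < 1]. *)
Lemma expint3_neq0 (al be d m : R) : 0 < be -> be < d -> d < al -> al < 1 / 2 -> `|m| < 1 ->
  expint d al m + expint (al + be) (d + al) m + expint (d + al + be) (1 + be) m != 0.
Proof.
move=> be0 bed dal al2 m1; apply/eqP => E.
have n0 := normr_ge0 m.
have smallM x : 0 <= x -> x <= 1 -> `|m| * x < 1.
  by move=> x0 x1; apply: le_lt_trans m1; rewrite -[leRHS]mulr1 ler_wpM2l.
have E2 : expint d (1 + be) m = expint al (al + be) m + expint (d + al) (d + al + be) m.
  have h1 : d <= al by lra.
  have h2 : al <= al + be by lra.
  have h3 : al + be <= d + al by lra.
  have h4 : d + al <= d + al + be by lra.
  have h5 : d + al + be <= 1 + be by lra.
  rewrite -(expintD m h1 (le_trans h2 (le_trans h3 (le_trans h4 h5)))).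
  rewrite -(expintD m h2 (le_trans h3 (le_trans h4 h5))) -(expintD m h3 (le_trans h4 h5)).
  rewrite -(expintD m h4 h5) -[RHS]addr0 -E; ring.
have G : expint al (al + be) m + expint (d + al) (d + al + be) m =
  Complex (2 * sinc be m * cos (pi * m * d)) 0 * expi (pi * m * (2 * al + be + d)).
  rewrite (@expint_polar al); last lra.
  rewrite (@expint_polar (d + al)); last lra.
  have -> : al + be - al = be by ring.
  have -> : d + al + be - (d + al) = be by ring.
  have -> : pi * m * (al + (al + be)) = pi * m * (2 * al + be + d) - pi * m * d by ring.
  have -> : pi * m * (d + al + (d + al + be)) = pi * m * (2 * al + be + d) + pi * m * d by ring.
  rewrite /expi cosB cosD sinB sinD.
  by apply: complex_ext; rewrite ?ReD ?ImD ?ReM ?ImM /=; ring.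
have p0 := pi_gt0 R.
have cd : 0 < cos (pi * m * d).
  apply: cos_gt0_pihalf; rewrite -ltr_norml !normrM (gtr0_norm p0) -mulrA ltr_pM2l//.
  have d0 : 0 < d by lra.
  rewrite (gtr0_norm d0); apply: (@le_lt_trans _ _ d); last by rewrite -[2^-1]mul1r; lra.
  by rewrite -[leRHS]mul1r ler_pM2r// ltW.
have sb : 0 < sinc be m by apply: sinc_gt0 => //; apply: smallM; lra.
move: E2; rewrite G expint_polar; last lra.
case/polar_eq => [||E2].
- by apply: sinc_gt0; [lra|apply: smallM; lra].
- by rewrite !mulr_gt0.
have -> : pi * m * (d + (1 + be)) - pi * m * (2 * al + be + d) = pi * (m * (1 - 2 * al)) by ring.
move=> /cos_eq1 h.
have : pi * (m * (1 - 2 * al)) = 0.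
  apply: h; rewrite normrM (gtr0_norm p0) mulrC ltr_pM2r// normrM.
  have a0 : 0 < 1 - 2 * al by lra.
  rewrite (gtr0_norm a0); apply: (@lt_trans _ _ 1); last by rewrite ltr1n.
  by apply: smallM; lra.
move=> /eqP; rewrite !mulf_eq0 (gt_eqF p0)/= => /orP[/eqP m0|/eqP]; last by lra.
by move: E2; rewrite m0 /sinc eqxx mulr0 mul0r cos0; lra.
Qed.

End Nonvanishing.

(** * Overlaps of two translated windows *)

Section OverlapTransform.
Context {R : realType}.
Local Notation C := (complex R).
Local Notation ip := (@inner R setT).
Variables alpha beta : R.
Hypotheses (alpha0 : 0 < alpha) (alpha2 : alpha < 1 / 2) (beta0 : 0 < beta).
Local Notation gab := (gabor (chi (two_intervals alpha beta))).
Implicit Types d m : R.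

(* The Fourier transform of [Omega `&` (Omega + d)] at frequency [m]. *)
Definition overlap_ft d m : C :=
  expint d alpha m +
  expint (Num.max (alpha + beta) d) (Num.min (1 + beta) (d + alpha)) m +
  expint (d + alpha + beta) (1 + beta) m.

Lemma inner_gabor_overlap t nu d nu' : 0 <= d ->
  ip (gab (t, nu)) (gab (t + d, nu')) =
  expi (2 * pi * (nu - nu') * t) * overlap_ft d (nu - nu').
Proof.
move=> d0; have b0 := beta0; have a0 := alpha0; rewrite inner_gabor// /overlap_ft; move: (nu - nu') => m.
have sh a b : expi (2 * pi * m * t) * expint a b m = expint (a + t) (b + t) m by rewrite expint_shift.
move: (expi _) sh => e sh; rewrite !mulrDr !sh.
have -> : Num.max t (t + d) = d + t by rewrite max_r ?lerDl// addrC.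
have -> : Num.min (t + alpha) (t + d + alpha) = alpha + t by rewrite min_l; lra.
have -> : Num.max (t + alpha + beta) (t + d) = Num.max (alpha + beta) d + t.
  by rewrite addr_maxl; congr Num.max; ring.
have -> : Num.min (t + 1 + beta) (t + d + alpha) = Num.min (1 + beta) (d + alpha) + t.
  by rewrite addr_minl; congr Num.min; ring.
have -> : Num.max (t + alpha + beta) (t + d + alpha + beta) = d + alpha + beta + t by rewrite max_r; lra.
have -> : Num.min (t + 1 + beta) (t + d + 1 + beta) = 1 + beta + t by rewrite min_l; lra.
(* The short piece of the earlier window ends before the long piece of the later one begins. *)
rewrite [X in _ + X + _]expint_empty ?addr0 -?addrA//.
by rewrite ge_min !le_max; apply/orP; left; apply/orP; right; lra.
Qed.

Let lt1_mul m x : `|m| < 1 -> 0 <= x -> x <= 1 -> `|m| * x < 1.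
Proof.
by move=> m1 x0 x1; apply: le_lt_trans m1; rewrite -[leRHS]mulr1 ler_wpM2l.
Qed.

(* For [d < alpha] and [d <= beta] the two pieces have lengths [alpha - d] and
   [1 - alpha - d], which differ because [alpha != 1/2]. *)
Let overlap_near d m : 0 <= d -> d < alpha -> d <= beta -> `|m| < 1 -> overlap_ft d m != 0.
Proof.
move=> d0 da db m1; have b0 := beta0; have a0 := alpha0; have a2 := alpha2.
apply/eqP; rewrite /overlap_ft [X in _ + X + _]expint_empty ?addr0; last first.
  by rewrite ge_min !le_max; apply/orP; right; apply/orP; left; lra.
by case/expint2_eq0; [lra|lra|apply: lt1_mul => //; lra|lra].
Qed.

(** In this range only the two long pieces meet. *)
Let overlap_tail d m : alpha <= d -> d <= beta -> d < 1 - alpha -> `|m| < 1 -> overlap_ft d m != 0.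
Proof.
move=> da db d1 m1; have b0 := beta0; have a0 := alpha0; have a2 := alpha2.
rewrite /overlap_ft [X in _ + X + _]expint_empty ?addr0; last first.
  by rewrite ge_min !le_max; apply/orP; right; apply/orP; left; lra.
rewrite expint_empty// add0r; apply: expint1_neq0; first lra.
by apply: lt1_mul => //; lra.
Qed.

(** Only the long piece of one window meets the short piece of the other. The overlap has length at
    most [alpha < 1/2], so its transform has no zero with [|m| < 2]. *)
Lemma overlap_far d m : 1 - alpha <= d -> beta < d -> d < 1 + beta -> `|m| < 2 -> overlap_ft d m != 0.
Proof.
move=> da db d1 m1; have b0 := beta0; have a0 := alpha0; have a2 := alpha2.
rewrite /overlap_ft [X in X + _ + _]expint_empty ?add0r; last lra.
rewrite [X in _ + X]expint_empty ?addr0; last lra.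
have L0 : Num.max (alpha + beta) d < Num.min (1 + beta) (d + alpha).
  by rewrite lt_min !gt_max; apply/andP; split; apply/andP; split; lra.
apply: expint1_neq0 => //.
have La : Num.min (1 + beta) (d + alpha) - Num.max (alpha + beta) d <= alpha.
  have : Num.min (1 + beta) (d + alpha) <= d + alpha by rewrite ge_min lexx orbT.
  have : d <= Num.max (alpha + beta) d by rewrite le_max lexx orbT.
  lra.
apply: (@le_lt_trans _ _ (`|m| * alpha)); first exact: ler_wpM2l.
have h : `|m| * alpha < 2 * alpha by rewrite ltr_pM2r.
by lra.
Qed.

(** The second bound on [|m|] serves the range where [d] is at least [alpha], exceeds [beta] and is
    below [1 - alpha]: there a mixed and a long overlap may have equal lengths. Their left endpoints
    are then [alpha + beta] or [d] apart, and equality of lengths makes twice this distance at most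
    [1 + beta - alpha], with equality in the second case. *)
Lemma overlap_short_gap d m : beta < 1 - alpha -> 0 <= d -> d < 1 + beta ->
  `|m| < 1 -> `|m| * (1 + beta - alpha) < 1 -> overlap_ft d m != 0.
Proof.
move=> ba d0 d1 m1 mH; have b0 := beta0; have a0 := alpha0; have a2 := alpha2.
have n0 := normr_ge0 m.
have [da|da] := ltP d alpha.
  have [db|db] := leP d beta; first exact: overlap_near.
  rewrite /overlap_ft max_l; last lra.
  by rewrite min_r; [exact: expint3_neq0|lra].
have [d1a|d1a] := leP (1 - alpha) d.
  by apply: overlap_far => //; lra.
have [db|db] := leP d beta; first exact: overlap_tail.
apply/eqP; rewrite /overlap_ft [X in X + _ + _]expint_empty ?add0r//.
rewrite min_r; last lra.
have [dab|dab] := leP (alpha + beta) d.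
  case/expint2_eq0; [lra|lra|by apply: lt1_mul => //; lra|].
  move=> E; have -> : d + alpha + beta - d = alpha + beta by ring.
  rewrite [`|alpha + beta|]ger0_norm; last lra.
  move=> h; have : `|m| * (2 * (alpha + beta)) <= `|m| * (1 + beta - alpha) by apply: ler_wpM2l => //; lra.
  by move: h mH; rewrite mulrCA !mulrA [2 * _]mulrC -!mulrA; lra.
case/expint2_eq0; [lra|lra|by apply: lt1_mul => //; lra|].
move=> E; have -> : d + alpha + beta - (alpha + beta) = d by ring.
rewrite [`|d|]ger0_norm//.
move=> h; have : `|m| * (2 * d) <= `|m| * (1 + beta - alpha) by apply: ler_wpM2l => //; lra.
by move: h mH; rewrite mulrCA !mulrA [2 * _]mulrC -!mulrA; lra.
Qed.

Lemma overlap_long_gap d m : 1 - alpha <= beta -> 0 <= d -> d < 1 - alpha ->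
  `|m| < 1 -> overlap_ft d m != 0.
Proof.
move=> ba d0 d1 m1; have b0 := beta0; have a0 := alpha0; have a2 := alpha2.
have [da|da] := ltP d alpha; first by apply: overlap_near => //; lra.
by apply: overlap_tail => //; lra.
Qed.

(** The sign of [m] depends on which of the two points comes first in time, so only its modulus is
    specified. *)
Lemma gabor_separation (Lambda : set (R * R)) l l' :
  gabor_onb (chi (two_intervals alpha beta)) Lambda -> Lambda l -> Lambda l' -> l != l' ->
  exists m, `|m| = `|l.2 - l'.2| /\ overlap_ft `|l.1 - l'.1| m = 0.
Proof.
move=> [[_ on] _].
have main (k k' : R * R) : Lambda k -> Lambda k' -> k != k' -> k.1 <= k'.1 ->
  overlap_ft `|k.1 - k'.1| (k.2 - k'.2) = 0.
  case: k k' => [t nu] [t' nu'] Lk Lk' kk /= tt.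
  have d0 : 0 <= t' - t by rewrite subr_ge0.
  have := on _ _ Lk Lk'; rewrite (negbTE kk) /=.
  have -> : t' = t + (t' - t) by ring.
  rewrite inner_gabor_overlap// => /eqP; rewrite mulf_eq0 => /orP[/eqP E|/eqP <-].
    have := sqnorm_expi (2 * pi * (nu - nu') * t); rewrite E /sqnorm /= expr0n /= addr0.
    by move=> /eqP; rewrite eq_sym oner_eq0.
  by congr overlap_ft; rewrite -normrN ger0_norm; lra.
move=> Ll Ll' ll; case: (leP l.1 l'.1) => h; first by exists (l.2 - l'.2); split => //; exact: main.
exists (l'.2 - l.2); split; first by rewrite distrC.
by rewrite distrC; apply: main => //; [rewrite eq_sym|exact: ltW].
Qed.

Lemma gabor_packing_bound (Lambda D B : set (R * R)) (w : R * R) :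
  gabor_onb (chi (two_intervals alpha beta)) Lambda -> countable Lambda ->
  measurable D -> measurable B ->
  (forall l l' u, Lambda l -> Lambda l' ->
    D (u.1 - l.1, u.2 - l.2) -> D (u.1 - l'.1, u.2 - l'.2) -> l = l') ->
  (forall u l, B u -> Lambda l -> ~ D (u.1 + w.1 - l.1, u.2 + w.2 - l.2)) ->
  ((@lebesgue_measure R \x @lebesgue_measure R)%E D +
   \int[(@lebesgue_measure R \x @lebesgue_measure R)%E]_(u in B) (Psi alpha beta u)%:E <= 1)%E.
Proof.
move=> onb cL mD mB dD dB.
apply: packing_bound cL mD mB dD dB.
- exact: Psi_ge0.
- exact: measurable_Psi.
- exact: integral_Psi.
- by move=> z d d0; exact: Psi_parseval onb d0.
Qed.

Lemma short_gap_no_onb (Lambda : set (R * R)) : beta < 1 - alpha ->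
  gabor_onb (chi (two_intervals alpha beta)) Lambda -> countable Lambda -> False.
Proof.
move=> ba onb cL; have b0 := beta0; have a0 := alpha0; have a2 := alpha2.
(* [H] is the smaller of 1 and [1 / (1 + beta - alpha)], the largest height compatible with both
   bounds of [overlap_short_gap]. The area [(1 + beta) * H] exceeds 1 because [alpha] and [beta] are
   positive. *)
have [H [H0 H1 H2 H3]] : exists H, [/\ 0 < H, H <= 1, H * (1 + beta - alpha) <= 1 & 1 < (1 + beta) * H].
  have [ab|ab] := leP alpha beta.
    have p : 0 < 1 + beta - alpha by lra.
    exists (1 + beta - alpha)^-1; split.
    - by rewrite invr_gt0.
    - by rewrite invf_le1//; lra.
    - by rewrite mulVf// gt_eqF.
    - by rewrite ltr_pdivlMr// mul1r; lra.
  by exists 1; split; lra.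
pose D : set (R * R) := `[0, 1 + beta[ `*` `[0, H[.
have := @gabor_packing_bound Lambda D set0 (0, 0) onb cL.
rewrite integral_set0 adde0 product_measure1E// /= !lebesgue_measure_itv/= !lte_fin H0 (_ : 0 < 1 + beta); last lra.
rewrite -!EFinB !subr0 -EFinM lee_fin => h.
have : (1 + beta) * H <= 1.
  apply: h => //; first exact: measurableX.
  move=> l l' u Ll Ll' [/= + +] [/= + +]; rewrite !in_itv/=.
  move=> /andP[h1 h2] /andP[h3 h4] /andP[h5 h6] /andP[h7 h8].
  apply/eqP; apply: contraT => ll.
  have [m [mE]] := gabor_separation onb Ll Ll' ll.
  have mH : `|m| < H by rewrite mE ltr_norml; apply/andP; split; lra.
  move=> /eqP; apply: contraLR => _; apply: overlap_short_gap => //.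
  - by rewrite ltr_norml; apply/andP; split; lra.
  - exact: lt_le_trans mH H1.
  - by apply: lt_le_trans H2; rewrite ltr_pM2r//; lra.
by move: H3; lra.
Qed.

End OverlapTransform.

(** * Tilings of the line by two intervals *)

Section TwoIntervalTiling.
Context {R : realType}.
Variables (alpha beta : R) (T : R -> Prop).
Local Notation Omega := (two_intervals alpha beta).
Hypothesis T_cover : forall x, exists2 t, T t & Omega (x - t).
Hypothesis T_disj : forall t t' x, T t -> T t' -> Omega (x - t) -> Omega (x - t') -> t = t'.

Lemma two_intervalsP v : Omega v <-> (0 <= v < alpha) \/ (alpha + beta <= v < 1 + beta).
Proof. by rewrite /two_intervals /= !in_itv. Qed.

Hypotheses (alpha0 : 0 < alpha) (alpha2 : alpha < 1 / 2) (beta0 : 0 < beta).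

Let T_head s t x : T s -> T t -> 0 <= x - s < alpha -> 0 <= x - t < alpha -> s = t.
Proof. by move=> Ts Tt h1 h2; apply: (T_disj Ts Tt (x := x)); apply/two_intervalsP; left. Qed.

Let T_mixed s t x : T s -> T t -> alpha + beta <= x - s < 1 + beta -> 0 <= x - t < alpha -> s = t.
Proof. by move=> Ts Tt h1 h2; apply: (T_disj Ts Tt (x := x)); apply/two_intervalsP; [right|left]. Qed.

Let T_tail s t x : T s -> T t -> alpha + beta <= x - s < 1 + beta ->
  alpha + beta <= x - t < 1 + beta -> s = t.
Proof. by move=> Ts Tt h1 h2; apply: (T_disj Ts Tt (x := x)); apply/two_intervalsP; right. Qed.

(* Two short pieces cannot be adjacent, as the corresponding long pieces would
   overlap; hence a long piece starts where the short piece of [t] ends. *)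
Let T_subbeta t : T t -> T (t - beta).
Proof.
move=> Tt; have a0 := alpha0; have a2 := alpha2; have b0 := beta0.
have [s Ts /two_intervalsP[/andP[h1 h2]|/andP[h1 h2]]] := T_cover (t + alpha).
  have E : s = t.
    apply: (T_tail Ts Tt (x := s + alpha + beta)); apply/andP; split; lra.
  by move: h2; rewrite E; lra.
have [h|h|<-//] := ltgtP s (t - beta); last by move: h1 h; lra.
(* A long piece of [s] starting before [t + alpha] meets the short piece of [t], either at its own
   left end or at [t], whichever comes later. *)
exfalso; have [h3|h3] := leP t (s + alpha + beta).
  have E : s = t by apply: (T_mixed Ts Tt (x := s + alpha + beta)); apply/andP; split; lra.
  by move: h; rewrite E; lra.
have E : s = t by apply: (T_mixed Ts Tt (x := t)); apply/andP; split; lra.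
by move: h; rewrite E; lra.
Qed.

(** If [s] covers [t + beta], then [s - beta], which is in [T] by [T_subbeta], covers [t] and so
    equals [t]. The same device yields [T_sub1] from [T_add1]. *)
Let T_addbeta t : T t -> T (t + beta).
Proof.
move=> Tt; have a0 := alpha0; have a2 := alpha2; have b0 := beta0.
have [s Ts Os] := T_cover (t + beta).
suff : t = s - beta by move=> ->; rewrite subrK.
apply: (T_disj Tt (T_subbeta Ts) (x := t)).
  by apply/two_intervalsP; left; rewrite subrr lexx.
by move: Os; rewrite opprB addrA.
Qed.

(* The short piece of [t] and the long piece of [t - beta] together fill [t, t + 1). *)
Let T_gap s t : T s -> T t -> t < s -> s < t + 1 -> False.
Proof.
move=> Ts Tt ts st; have a0 := alpha0; have a2 := alpha2; have b0 := beta0.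
have [h|h] := ltP s (t + alpha).
  have E : s = t by apply: (T_head Ts Tt (x := s)); apply/andP; split; lra.
  by move: ts; rewrite E ltxx.
have E : t - beta = s by apply: (T_mixed (T_subbeta Tt) Ts (x := s)); apply/andP; split; lra.
by move: ts; rewrite -E; lra.
Qed.

(** If [t + 1] lay in the long piece of [s], then [s + beta] would fall strictly between [t] and
    [t + 1]; in the short piece, [s] itself would, unless it is [t + 1]. *)
Let T_add1 t : T t -> T (t + 1).
Proof.
move=> Tt; have a0 := alpha0; have a2 := alpha2; have b0 := beta0.
have [s Ts /two_intervalsP[/andP[h1 h2]|/andP[h1 h2]]] := T_cover (t + 1).
  have [h|h|<-//] := ltgtP s (t + 1); last by move: h1 h; lra.
  by exfalso; apply: (T_gap Ts Tt) => //; lra.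
by exfalso; apply: (T_gap (T_addbeta Ts) Tt); lra.
Qed.

Let T_sub1 t : T t -> T (t - 1).
Proof.
move=> Tt; have a0 := alpha0; have a2 := alpha2; have b0 := beta0.
have [s Ts Os] := T_cover (t - 1).
suff : t = s + 1 by move=> ->; rewrite addrK.
apply: (T_disj Tt (T_add1 Ts) (x := t)).
  by apply/two_intervalsP; left; rewrite subrr lexx.
by move: Os; rewrite opprD addrA addrAC.
Qed.

Let T_addz t (k : int) : T t -> T (t + k%:~R).
Proof.
move=> Tt; case: k => n.
  elim: n => [|n ih]; first by rewrite addr0.
  by rewrite -addn1 PoszD intrD addrA; exact: T_add1.
rewrite NegzE mulrNz; elim: n.+1 => [|m ih]; first by rewrite subr0.
by rewrite -addn1 PoszD intrD opprD addrA; exact: T_sub1.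
Qed.

Let T_integers s t : T s -> T t -> exists k : int, s = t + k%:~R.
Proof.
move=> Ts Tt; exists (Num.floor (s - t)).
have /andP[h1 h2] := floor_itv (s - t).
have Tk := T_addz (Num.floor (s - t)) Tt.
move: h1 h2 Tk; rewrite intrD mulr1z; move: ((Num.floor _)%:~R) => k h1 h2 Tk.
have [h|h|//] := ltgtP s (t + k).
  by move: h1 h; lra.
by exfalso; apply: (T_gap Ts Tk h); lra.
Qed.

(** [T] is stable under integer shifts and has gaps of at least 1, so it is a single coset of the
    integers; it contains both [t] and [t - beta]. *)
Lemma two_interval_tiling :
  (exists n : int, beta = n%:~R) /\
  exists c, 0 <= c < 1 /\ forall t, T t <-> exists k : int, t = c + k%:~R.
Proof.
have [t Tt _] := T_cover 0; split.
  have [k E] := T_integers Tt (T_subbeta Tt).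
  by exists k; move: E; lra.
exists (t - (Num.floor t)%:~R).
have Tc : T (t - (Num.floor t)%:~R) by rewrite -mulrNz; exact: T_addz.
split.
  by have := floor_itv t; rewrite intrD mulr1z; move: ((Num.floor _)%:~R) => k; lra.
move=> s; split; first by move=> Ts; exact: T_integers.
by move=> [k ->]; exact: T_addz.
Qed.

End TwoIntervalTiling.

(** * Covering of the plane *)

Section Covering.
Context {R : realType}.
Local Notation mu := (@lebesgue_measure R).
Variables (alpha beta : R) (Lambda : set (R * R)).
Local Notation Omega := (two_intervals alpha beta).
Hypotheses (alpha0 : 0 < alpha) (alpha2 : alpha < 1 / 2) (beta0 : 0 < beta).
Hypothesis long_gap : 1 - alpha <= beta.
Hypothesis onb : gabor_onb (chi Omega) Lambda.
Hypothesis cLambda : countable Lambda.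

Lemma far_separation l l' : Lambda l -> Lambda l' ->
  beta < `|l.1 - l'.1| -> `|l.1 - l'.1| < 1 + beta -> 2 <= `|l.2 - l'.2|.
Proof.
move=> Ll Ll' h1 h2; have b0 := beta0; have lg := long_gap; have [E|ll] := eqVneq l l'.
  by move: h1; rewrite E subrr normr0; lra.
have [m [mE]] := gabor_separation alpha0 beta0 onb Ll Ll' ll.
move=> /eqP; apply: contraLR; rewrite -ltNge -mE => m2; apply: overlap_far => //; lra.
Qed.

Lemma near_separation l l' : Lambda l -> Lambda l' -> l != l' ->
  `|l.1 - l'.1| < 1 - alpha -> 1 <= `|l.2 - l'.2|.
Proof.
move=> Ll Ll' ll h1; have [m [mE]] := gabor_separation alpha0 beta0 onb Ll Ll' ll.
move=> /eqP; apply: contraLR; rewrite -ltNge -mE => m2; apply: overlap_long_gap => //.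
Qed.

(** If [x] lies in pieces of the same kind, the times are less than [1 - alpha] apart; in pieces of
    different kinds, their distance is between [beta] and [1 + beta]. These are the two ranges where
    the overlap transform is controlled. *)
Lemma Omega_separation l l' x : Lambda l -> Lambda l' -> l != l' ->
  Omega (x - l.1) -> Omega (x - l'.1) -> 1 <= `|l.2 - l'.2|.
Proof.
have a0 := alpha0; have a2 := alpha2; have b0 := beta0; have lg := long_gap.
move=> Ll Ll' ll /two_intervalsP[|] /andP[h1 h2] /two_intervalsP[|] /andP[h3 h4].
- by apply: near_separation => //; rewrite ltr_norml; apply/andP; split; lra.
- have h : beta < l.1 - l'.1 by lra.
  apply: (@le_trans _ _ 2); first by rewrite ler1n.
  by apply: far_separation => //; rewrite ger0_norm; lra.
- have h : beta < l'.1 - l.1 by lra.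
  apply: (@le_trans _ _ 2); first by rewrite ler1n.
  by apply: far_separation => //; rewrite distrC ger0_norm; lra.
- by apply: near_separation => //; rewrite ltr_norml; apply/andP; split; lra.
Qed.

Let D : set (R * R) := Omega `*` `[0, 1[.

Let D_disj l l' u : Lambda l -> Lambda l' ->
  D (u.1 - l.1, u.2 - l.2) -> D (u.1 - l'.1, u.2 - l'.2) -> l = l'.
Proof.
move=> Ll Ll' [/= O1 +] [/= O2 +]; rewrite !in_itv/= => /andP[h1 h2] /andP[h3 h4].
apply/eqP; apply: contraT => ll; have := Omega_separation Ll Ll' ll O1 O2.
by rewrite leNgt ltr_norml => /negP[]; apply/andP; split; lra.
Qed.

Let measurable_Omega : measurable Omega.
Proof. exact: measurableU. Qed.

Let measurable_D : measurable D.
Proof. exact: measurableX. Qed.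

Let mu_Omega : mu Omega = 1%:E.
Proof.
have a0 := alpha0; have a2 := alpha2; have b0 := beta0.
rewrite measureU//.
  rewrite /= !lebesgue_measure_itv/= !lte_fin alpha0 (_ : alpha + beta < 1 + beta); last lra.
  by rewrite -!EFinB -EFinD; congr EFin; ring.
by apply/seteqP; split => // t /=; rewrite !in_itv/= => -[/andP[_ h1] /andP[h2 _]]; lra.
Qed.

Let mu_D : ((mu \x mu)%E D = 1)%E.
Proof.
transitivity (mu Omega * mu `[0%R, 1%R[)%E; first exact: product_measure1E.
rewrite mu_Omega mul1e lebesgue_measure_itv/= lte_fin ltr01.
by rewrite -EFinB subr0.
Qed.

(** As [alpha + beta >= 1], the long piece of the shifted window lies to the right of [[0, 1)],
    while the short piece [[t, t + alpha)] lies inside it. *)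
Let Psi_gt0 u : 0 <= u.1 -> u.1 < 1 / 2 -> 0 <= u.2 -> u.2 < 1 -> 0 < Psi alpha beta u.
Proof.
case: u => t m /= h1 h2 h3 h4; have a0 := alpha0; have a2 := alpha2; have b0 := beta0; have lg := long_gap.
rewrite lt_neqAle Psi_ge0 andbT eq_sym /Psi inner_box_gabor//.
rewrite [X in _ + X]expint_empty ?addr0; last by rewrite ge_min le_max; apply/orP; left; apply/orP; right; lra.
rewrite max_r// min_r; last lra.
rewrite expint_polar; last lra.
rewrite sqnormM sqnorm_expi mulr1 /sqnorm /= expr0n /= addr0 sqrf_eq0 gt_eqF//.
apply: sinc_gt0; first lra.
rewrite sub0r normrN ger0_norm//.
have -> : t + alpha - t = alpha by ring.
apply: (@le_lt_trans _ _ (1 * alpha)); last lra.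
by rewrite ler_pM2r// ltW.
Qed.

Let box_integral_gt0 (d : R) : 0 < d -> d <= 1 / 2 ->
  (0 < \int[mu \x mu]_(u in `[0%R, d[ `*` `[0%R, d[) (Psi alpha beta u)%:E)%E.
Proof.
move=> d0 d2; set B := _ `*` _.
have mB : measurable B by exact: measurableX.
have mf : measurable_fun B (fun u => (Psi alpha beta u)%:E).
  apply/measurable_EFinP; by apply: measurable_funS (measurable_Psi alpha beta0).
rewrite lt_neqAle integral_ge0 ?andbT; last by move=> u _; rewrite lee_fin Psi_ge0.
apply/eqP => /esym E.
have : (\int[mu \x mu]_(u in B) `|(Psi alpha beta u)%:E| = 0)%E.
  rewrite -E; apply: eq_integral => u _.
  by rewrite gee0_abs// lee_fin Psi_ge0.
move=> /(ae_eq_integral_abs (mu \x mu)%E mB mf) nB.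
have : (mu \x mu)%E.-negligible B.
  apply: negligibleS nB => -[t m] Bu /= /(_ Bu) [E0].
  case: Bu; rewrite /= !in_itv/= => /andP[h1 h2] /andP[h3 h4].
  have t2 : t < 1 / 2 by lra.
  have m1 : m < 1 by lra.
  by have := @Psi_gt0 (t, m) h1 t2 h3 m1; rewrite E0 ltxx.
have muB : ((mu \x mu)%E B = (d * d)%:E)%E.
  transitivity (mu `[0%R, d[ * mu `[0%R, d[)%E; first exact: product_measure1E.
  by rewrite lebesgue_measure_itv/= lte_fin d0 -EFinB subr0 -EFinM.
move=> nB2; have /= muB0 := @measure_negligible _ _ _ (mu \x mu)%E B mB nB2.
have [] := etrans (esym muB) muB0.
by move=> /eqP; rewrite mulf_eq0 orbb (gt_eqF d0).
Qed.

Let same_cell (a c h : R) : 0 < h -> 0 <= a -> 0 <= c ->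
  Num.truncn (a / h) = Num.truncn (c / h) -> `|a - c| < h.
Proof.
move=> h0 a0 c0 E.
have := truncn_itv (divr_ge0 a0 (ltW h0)); have := truncn_itv (divr_ge0 c0 (ltW h0)).
rewrite E -natr1; move: ((Num.truncn _)%:R) => n /andP[h1 h2] /andP[h3 h4].
have -> : a - c = (a / h - c / h) * h by field; exact: lt0r_neq0.
rewrite normrM (gtr0_norm h0) -[ltRHS]mul1r ltr_pM2r// ltr_norml; apply/andP; split; lra.
Qed.

Let bounded_cell (a h : R) (N : R) : 0 < h -> 0 <= a -> a < N ->
  (Num.truncn (a / h) < (Num.truncn (N / h)).+1)%N.
Proof.
move=> h0 a0 aN; rewrite ltnS; apply: le_truncn.
by rewrite ler_pM2r ?invr_gt0// ltW.
Qed.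

(** A cell of width [alpha] and height 1 holds at most one point, by [near_separation] and
    [alpha < 1 - alpha]; [g] recovers the point from its cell. *)
Lemma locally_finite (x y K : R) :
  finite_set [set l | [/\ Lambda l, `|l.1 - x| < K & `|l.2 - y| < K]].
Proof.
set S := [set l | _].
pose f (l : R * R) := (Num.truncn ((l.1 - (x - K)) / alpha), Num.truncn ((l.2 - (y - K)) / 1)).
pose g c := xget (0, 0) [set l | S l /\ f l = c].
have a0 := alpha0; have a2 := alpha2.
apply: (@sub_finite_set _ _ (g @` (`I_(Num.truncn (2 * K / alpha)).+1 `*` `I_(Num.truncn (2 * K / 1)).+1))); last first.
  by apply: finite_image; apply: finite_setX; exact: finite_II.
have bnd (a b : R) : `|a - b| < K -> 0 <= a - (b - K) /\ a - (b - K) < 2 * K.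
  by rewrite ltr_norml => /andP[h1 h2]; split; lra.
move=> l Sl; have [Ll l1 l2] := Sl; have [l1a l1b] := bnd _ _ l1; have [l2a l2b] := bnd _ _ l2.
exists (f l); first by split => /=; apply: bounded_cell.
have : [set l' | S l' /\ f l' = f l] (g (f l)) by apply: xgetPex; exists l.
move=> [[Lg g1 g2]]; have [g1a g1b] := bnd _ _ g1; have [g2a g2b] := bnd _ _ g2.
move=> [E1 E2]; apply/eqP; apply: contraT => ne.
have := near_separation Lg Ll ne.
have := same_cell alpha0 g1a l1a E1; have := same_cell ltr01 g2a l2a E2.
have -> : (g (f l)).1 - (x - K) - (l.1 - (x - K)) = (g (f l)).1 - l.1 by ring.
have -> : (g (f l)).2 - (y - K) - (l.2 - (y - K)) = (g (f l)).2 - l.2 by ring.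
move=> h2 h1 h3; have := h3 _; rewrite leNgt h2; apply.
by apply: lt_trans h1 _; lra.
Qed.

Let Omega_right v : ~ Omega v -> exists2 e, 0 < e & forall h, 0 <= h -> h < e -> ~ Omega (v + h).
Proof.
have a0 := alpha0; have a2 := alpha2; have b0 := beta0 => nO.
have [v0|v0] := ltP v 0.
  by exists (- v); [lra|move=> h h0 h1 /two_intervalsP[] /andP[]; lra].
have [va|va] := ltP v alpha.
  by exfalso; apply: nO; apply/two_intervalsP; left; rewrite v0.
have [vb|vb] := ltP v (alpha + beta).
  by exists (alpha + beta - v); [lra|move=> h h0 h1 /two_intervalsP[] /andP[]; lra].
have [vc|vc] := ltP v (1 + beta).
  by exfalso; apply: nO; apply/two_intervalsP; right; rewrite vb.
by exists 1; [|move=> h h0 h1 /two_intervalsP[] /andP[]; lra].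
Qed.

Let unit_right v : ~ (0 <= v < 1) -> exists2 e : R, 0 < e & forall h, 0 <= h -> h < e -> ~ (0 <= v + h < 1).
Proof.
move=> nO; have [v0|v0] := ltP v 0.
  by exists (- v); [lra|move=> h h0 h1 /andP[]; lra].
have [va|va] := ltP v 1; first by exfalso; apply: nO; rewrite v0.
by exists 1; [|move=> h h0 h1 /andP[]; lra].
Qed.

Let uniform_radius (S : seq (R * R)) (Q : R -> R * R -> Prop) :
  (forall l e e', Q e l -> e' <= e -> Q e' l) ->
  (forall l, l \in S -> exists2 e, 0 < e & Q e l) ->
  exists2 e, 0 < e & forall l, l \in S -> Q e l.
Proof.
move=> mono; elim: S => [|l S ih] H; first by exists 1.
have [|e e0 He] := ih; first by move=> k kS; apply: H; rewrite inE kS orbT.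
have [|e' e'0 He'] := H l; first by rewrite mem_head.
exists (Num.min e e'); first by rewrite lt_min e0.
move=> k; rewrite inE => /orP[/eqP ->|kS].
  by apply: mono He' _; rewrite ge_min lexx orbT.
by apply: mono (He _ kS) _; rewrite ge_min lexx.
Qed.

(** An uncovered point stays uncovered by each single tile on a small square to its upper right;
    local finiteness makes the square uniform. With [|D| = 1] the packing bound leaves no room for
    the positive integral of [Psi] over it. *)
Lemma gabor_covering x y : exists2 l, Lambda l & Omega (x - l.1) /\ 0 <= y - l.2 < 1.
Proof.
have a0 := alpha0; have a2 := alpha2; have b0 := beta0.
apply: contrapT => nc.
pose Q e (l : R * R) := forall h k, 0 <= h < e -> 0 <= k < e -> ~ D (h + x - l.1, k + y - l.2).
have monoQ l e e' : Q e l -> e' <= e -> Q e' l.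
  by move=> Qe ee h k /andP[h1 h2] /andP[k1 k2]; apply: Qe; apply/andP; split => //; lra.
have localQ l : Lambda l -> exists2 e, 0 < e & Q e l.
  move=> Ll; have [inO|nO1] := pselect (Omega (x - l.1)).
    have [|e e0 He] := @unit_right (y - l.2); first by move=> h; apply: nc; exists l.
    exists e => // h k _ /andP[k1 k2] [_ /=]; rewrite in_itv/= -addrA addrC.
    exact: He.
  have [e e0 He] := Omega_right nO1.
  exists e => // h k /andP[h1 h2] _ [/= + _]; rewrite -addrA addrC.
  exact: He.
(* [D] lies in [[0, 1 + beta) x [0, 1)] and the square will have side at most 1/2, so tiles of
   points farther away than [3 + beta] in some coordinate cannot reach it. *)
have [S SE] := iffLR (finite_seqP _) (locally_finite x y (3 + beta)).
have [|e e0 He] := @uniform_radius S Q monoQ.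
  move=> l lS; have : [set` S] l by [].
  by rewrite -SE => -[Ll _ _]; exact: localQ.
have [d [d0 d2 de]] : exists d, [/\ 0 < d, d <= 1 / 2 & d <= e].
  by exists (Num.min (1 / 2) e); rewrite lt_min e0 !ge_min !lexx orbT andbT; split => //; lra.
have Qd l : Lambda l -> Q d l.
  move=> Ll; have [lnear|far] := pselect (`|l.1 - x| < 3 + beta /\ `|l.2 - y| < 3 + beta).
    apply: monoQ de; apply: He.
    by have : [set` S] l by rewrite -SE; case: lnear.
  move=> h k /andP[h1 h2] /andP[k1 k2] [/= /two_intervalsP O1]; rewrite in_itv/= => /andP[k3 k4].
  apply: far; rewrite !ltr_norml; split; last by apply/andP; split; lra.
  by case: O1 => /andP[q1 q2]; apply/andP; split; lra.
have := @gabor_packing_bound R alpha beta alpha0 alpha2 beta0 Lambda D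
  (`[0, d[ `*` `[0, d[) (x, y) onb cLambda measurable_D.
rewrite mu_D => h; have : (1 + \int[mu \x mu]_(u in `[0%R, d[ `*` `[0%R, d[) (Psi alpha beta u)%:E <= 1)%E.
  apply: h; [exact: measurableX|exact: D_disj|].
  by move=> [h k] l [/= + +] Ll; rewrite !in_itv/= => h1 k1; apply: (Qd l Ll h k).
apply/negP; rewrite -ltNge lteDl//; exact: box_integral_gt0.
Qed.

End Covering.

(** * Structure of Lambda *)

Section Restriction.
Context {R : realType}.
Local Notation mu := (@lebesgue_measure R).
Local Notation C := (complex R).
Local Notation normc := (@ComplexField.Normc.normc R).
Variable A : set R.

Lemma norm2sq_restrict (f : R -> C) : norm2sq A f = norm2sq setT (fun x => chi A x * f x).
Proof.
rewrite /norm2sq integral_mkcond; apply: eq_integral => x _.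
rewrite patchE !sqnormE sqnormM /sqnorm /= expr0n /= addr0 indicE.
by case: (_ \in A); rewrite /= ?expr1n ?mul1r ?expr0n ?mul0r.
Qed.

Lemma inner_restrict (f h : R -> C) :
  inner A f h = inner setT (fun x => chi A x * f x) (fun x => chi A x * h x).
Proof.
rewrite /inner /cintegral ![Rintegral mu A _]Rintegral_mkcond.
have chiE x : chi A x = (x \in A)%:R :> C.
  by rewrite /chi indicE; case: (x \in A).
by congr Complex; apply: eq_Rintegral => x _; rewrite patchE !chiE;
  case: (x \in A); rewrite /= ?mul1r ?mul0r.
Qed.

Lemma memL2_restrict (f : R -> C) : measurable A ->
  memL2 A f <-> memL2 setT (fun x => chi A x * f x).
Proof.
move=> mA; rewrite /memL2 -norm2sq_restrict.
have chiE x : chi A x = (x \in A)%:R :> C.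
  by rewrite /chi indicE; case: (x \in A).
have E1 : (fun x => complex.Re (chi A x * f x)) = (fun x => complex.Re (f x)) \_ A.
  by apply/funext => x; rewrite patchE chiE; case: (x \in A); rewrite ?mul1r ?mul0r.
have E2 : (fun x => complex.Im (chi A x * f x)) = (fun x => complex.Im (f x)) \_ A.
  by apply/funext => x; rewrite patchE chiE; case: (x \in A); rewrite ?mul1r ?mul0r.
rewrite E1 E2; split => -[m1 m2 n]; split => //; try exact/(measurable_restrictT _ mA).
Qed.

End Restriction.

(** * Common time offset, frequency fibres and standardness *)

Section Structure.
Context {R : realType}.
Local Notation mu := (@lebesgue_measure R).
Local Notation C := (complex R).
Variables (alpha beta : R) (Lambda : set (R * R)).
Local Notation Omega := (two_intervals alpha beta).
Local Notation gab := (gabor (chi Omega)).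
Hypotheses (alpha0 : 0 < alpha) (alpha2 : alpha < 1 / 2) (beta0 : 0 < beta).
Hypothesis onb : gabor_onb (chi Omega) Lambda.
Hypothesis cLambda : countable Lambda.

Let long_gap : 1 - alpha <= beta.
Proof.
rewrite leNgt; apply/negP => h; exact: (short_gap_no_onb alpha0 alpha2 beta0 h onb cLambda).
Qed.

(** The horizontal slice at height [y] of the plane tiling [D + Lambda]. *)
Let T y t := exists2 nu, Lambda (t, nu) & 0 <= y - nu < 1.

Let Omega0 t : Omega (t - t).
Proof. by apply/two_intervalsP; left; rewrite subrr lexx. Qed.

Let T_cover y x : exists2 t, T y t & Omega (x - t).
Proof.
have [[t nu] Ll [/= O1 O2]] := gabor_covering alpha0 alpha2 beta0 long_gap onb cLambda x y.
by exists t => //; exists nu.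
Qed.

Let T_disj y t t' x : T y t -> T y t' -> Omega (x - t) -> Omega (x - t') -> t = t'.
Proof.
move=> [nu L1 /andP[h1 h2]] [nu' L2 /andP[h3 h4]] O1 O2; apply/eqP; apply: contraT => tt.
have ne : (t, nu) != (t', nu') by rewrite xpair_eqE negb_and tt.
have := Omega_separation alpha0 alpha2 beta0 long_gap onb L1 L2 ne O1 O2.
by rewrite /= leNgt ltr_norml => /negP[]; apply/andP; split; lra.
Qed.

Let offset : {c : R -> R & forall y, 0 <= c y < 1 /\
  forall t, T y t <-> exists k : int, t = c y + k%:~R}.
Proof.
apply: (@choice _ _ (fun y c => 0 <= c < 1 /\
  forall t, T y t <-> exists k : int, t = c + k%:~R)) => y.
by have [_ [c hc]] := two_interval_tiling (@T_cover y) (@T_disj y) alpha0 alpha2 beta0; exists c.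
Qed.

Let c := projT1 offset.

Let c_itv y : 0 <= c y < 1. Proof. by case: (projT2 offset y). Qed.

Let cP y t : T y t <-> exists k : int, t = c y + k%:~R.
Proof. by case: (projT2 offset y). Qed.

(** As [beta] is an integer, [c y] and [c y' + beta] are times of points in the two slices, and they
    differ by an amount in [(beta, 1 + beta)]. Their frequencies lie in [(y - 1, y]] and
    [(y' - 1, y']], hence less than 2 apart, against [far_separation]. *)
Let c_le y y' : c y < c y' -> `|y - y'| <= 1 -> False.
Proof.
move=> cc yy; have b0 := beta0.
have [[n bn] _] := two_interval_tiling (@T_cover 0) (@T_disj 0) alpha0 alpha2 beta0.
have [nu L1 /andP[h1 h2]] : T y (c y) by apply/cP; exists 0; rewrite addr0.
have [nu' L2 /andP[h3 h4]] : T y' (c y' + n%:~R) by apply/cP; exists n.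
have /andP[c1 c2] := c_itv y; have /andP[c3 c4] := c_itv y'.
move: L2; rewrite -bn => L2.
have E : `|c y - (c y' + beta)| = c y' - c y + beta.
  by rewrite -normrN ger0_norm; lra.
have := far_separation alpha0 alpha2 beta0 long_gap onb L1 L2; rewrite /= E => h.
have : 2 <= `|nu - nu'| by apply: h; lra.
move: yy; rewrite ler_norml => /andP[y1 y2].
by rewrite leNgt ltr_norml => /negP[]; apply/andP; split; lra.
Qed.

Let c_eq y y' : `|y - y'| <= 1 -> c y = c y'.
Proof.
move=> yy; have [h|h|//] := ltgtP (c y) (c y').
  by exfalso; exact: c_le h yy.
by exfalso; apply: c_le h _; rewrite distrC.
Qed.

Let c_const y : c y = c 0.
Proof.
have shift (n : nat) z : c (z + n%:R) = c z.
  elim: n => [|n ih]; first by rewrite addr0.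
  rewrite -ih; apply: c_eq.
  by rewrite -natr1 (_ : _ - _ = 1); [rewrite normr1|ring].
have fl := floor_itv y.
transitivity (c (y - (Num.floor y)%:~R)).
  case: (Num.floor y) => n; first by rewrite -[RHS](shift n) subrK.
  by rewrite NegzE mulrNz opprK shift.
apply: c_eq; move: fl; rewrite intrD mulr1z; move: ((Num.floor _)%:~R) => k /andP[h1 h2].
by rewrite subr0 ger0_norm; lra.
Qed.

Let c0 := c 0.

Let time_offset t nu : Lambda (t, nu) -> exists k : int, t = c0 + k%:~R.
Proof.
move=> L1; have /cP[k] : T nu t by exists nu => //; rewrite subrr lexx ltr01.
by rewrite c_const; exists k.
Qed.

Let column_cover (k : int) y : exists2 nu, Lambda (c0 + k%:~R, nu) & 0 <= y - nu < 1.
Proof. by have : T y (c0 + k%:~R) by apply/cP; exists k; rewrite c_const. Qed.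

Let column_gap t nu nu' : Lambda (t, nu) -> Lambda (t, nu') -> `|nu - nu'| < 1 -> nu = nu'.
Proof.
move=> L1 L2 nn; apply/eqP; apply: contraT => ne.
have ne' : (t, nu) != (t, nu') by rewrite xpair_eqE negb_and ne orbT.
have := Omega_separation alpha0 alpha2 beta0 long_gap onb L1 L2 ne' (Omega0 t) (Omega0 t).
by rewrite /= leNgt nn.
Qed.

(** The point covering height [nu + 1] has frequency in [(nu, nu + 1]]; any value below [nu + 1]
    would be too close to [nu]. *)
Let column_up t nu : Lambda (t, nu) -> Lambda (t, nu + 1).
Proof.
move=> L1; have [k E] := time_offset L1; have [nu' L2 /andP[h1 h2]] := column_cover k (nu + 1).
move: L2; rewrite -E => L2; suff <- : nu' = nu + 1 by [].
have [h|h] := ltP nu' (nu + 1); last by lra.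
have : nu' = nu by apply: column_gap L2 L1 _; rewrite ltr_norml; apply/andP; split; lra.
by lra.
Qed.

(** The cover only places [nu'] in [(nu - 2, nu - 1]]; raised by [column_up], it comes within
    distance less than 1 of [nu]. *)
Let column_down t nu : Lambda (t, nu) -> Lambda (t, nu - 1).
Proof.
move=> L1; have [k E] := time_offset L1; have [nu' L2 /andP[h1 h2]] := column_cover k (nu - 1).
move: L2; rewrite -E => L2; suff <- : nu' = nu - 1 by [].
have : nu' + 1 = nu.
  by apply: column_gap (column_up L2) L1 _; rewrite ltr_norml; apply/andP; split; lra.
by lra.
Qed.

Let column_shift t nu (n : int) : Lambda (t, nu) -> Lambda (t, nu + n%:~R).
Proof.
move=> L1; case: n => n.
  elim: n => [|n ih]; first by rewrite addr0.
  by rewrite -addn1 PoszD intrD addrA; exact: column_up.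
rewrite NegzE mulrNz; elim: n.+1 => [|m ih]; first by rewrite subr0.
by rewrite -addn1 PoszD intrD opprD addrA; exact: column_down.
Qed.

Let column (k : int) : exists a, 0 <= a < 1 /\
  forall nu, Lambda (c0 + k%:~R, nu) <-> exists n : int, nu = n%:~R + a.
Proof.
have [nu0 L0 _] := column_cover k 0.
have La := column_shift (- Num.floor nu0) L0.
have fl := floor_itv nu0.
exists (nu0 + (- Num.floor nu0)%:~R); split.
  by move: fl; rewrite mulrNz intrD mulr1z; move: ((Num.floor _)%:~R) => k' /andP[h1 h2]; apply/andP; split; lra.
move: La; move: (nu0 + _) => a La nu; split; last by move=> [n ->]; rewrite [n%:~R + a]addrC; exact: column_shift.
move=> L1; exists (Num.floor (nu - a)); rewrite addrC.
apply: column_gap L1 (column_shift _ La) _.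
have := floor_itv (nu - a); rewrite intrD mulr1z; move: ((Num.floor _)%:~R) => k' /andP[h1 h2].
by rewrite ltr_norml; apply/andP; split; lra.
Qed.

Lemma gabor_integer_fibres : exists (t0 : R) (a : int -> R),
  [/\ 0 <= t0 < 1, forall k : int, 0 <= a k < 1, Lambda = integer_fibres t0 a &
      (exists (k : int) (nu : R), Lambda (k%:~R, nu)) -> Lambda = integer_fibres 0 a].
Proof.
have [a aP] := choice column.
have E : Lambda = integer_fibres c0 a.
  apply/seteqP; split => [[t nu] L1|[t nu] [k _ [/= -> [n _ <-]]]].
    have [k E] := time_offset L1; exists k => //; split => //=.
    have L2 : Lambda (c0 + k%:~R, nu) by rewrite -E.
    by have [n ->] := iffLR ((aP k).2 nu) L2; exists n.
  by apply/(aP k).2; exists n.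
exists c0, a; split => //; first exact: c_itv.
  by move=> k; case: (aP k).
move=> [k [nu L1]]; suff c00 : c0 = 0 by rewrite {1}E c00.
have [j kj] := time_offset L1; have /andP[h1 h2] := c_itv 0.
have cE : c0 = (k - j)%:~R by rewrite intrB kj addrK.
move: h1 h2; rewrite -/c0 cE -[1]/(1%:~R) ler0z ltrz1 => h1 h2.
by have -> : k - j = 0 by apply/eqP; rewrite eq_le h1 andbT -ltzD1.
Qed.

(** With a common offset every time of [Lambda] already occurs in the slice at height 0, where
    translates of [Omega] are disjoint. *)
Let tile_disj l l' x : Lambda l -> Lambda l' -> Omega (x - l.1) -> Omega (x - l'.1) -> l.1 = l'.1.
Proof.
case: l l' => [t nu] [t' nu'] L1 L2 /=; apply: (@T_disj 0).
  by apply/cP; exact: time_offset L1.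
by apply/cP; exact: time_offset L2.
Qed.

Let translateP t x : translate Omega t x <-> Omega (x - t).
Proof.
split; first by move=> [z Oz <-]; rewrite addrK.
by move=> O1; exists (x - t) => //; rewrite subrK.
Qed.

Let chi_translate t x : chi (translate Omega t) x = chi Omega (x - t) :> C.
Proof.
rewrite /chi !indicE; congr (Complex (_ : bool)%:R 0); apply/idP/idP; rewrite !inE => /translateP //.
Qed.

Let gaborE t nu x : chi (translate Omega t) x * character nu x = gab (t, nu) x.
Proof. by rewrite chi_translate. Qed.

Let measurable_translate t : measurable (translate Omega t).
Proof.
rewrite (_ : translate Omega t = `[t, t + alpha[ `|` `[t + alpha + beta, t + 1 + beta[); first exact: measurableU.
apply/seteqP; split => x; rewrite /= !in_itv/=.
  by move=> /translateP/two_intervalsP[|] /andP[h1 h2]; [left|right]; apply/andP; split; lra.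
move=> h; apply/translateP/two_intervalsP.
by case: h => /andP[h1 h2]; [left|right]; apply/andP; split; lra.
Qed.

Lemma gabor_standard : standard Omega Lambda.
Proof.
exists [set t | exists nu, Lambda (t, nu)], (fun t => [set nu | Lambda (t, nu)]); split.
- apply/seteqP; split => [[t nu] L1|[t nu] [_ _ [/= -> L1]]//].
  by exists t => //; exists nu.
- apply/seteqP; split => // x _.
  have [[t nu] L1 [tO _]] := gabor_covering alpha0 alpha2 beta0 long_gap onb cLambda x 0.
  by exists t; [exists nu|exact: (translateP t x).2].

move=> t [nu0 L0]; have [[_ on] dense] := onb.
have mA := measurable_translate t.
have gE nu : (fun x => chi (translate Omega t) x * character nu x) = gab (t, nu).
  by apply/funext => x; exact: gaborE.
split; first split.
- move=> nu L1; apply/(memL2_restrict _ mA); rewrite gE; apply: memL2_bcs; exact: bcsC_gabor.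
- move=> nu nu' L1 L2; rewrite inner_restrict !gE on// xpair_eqE eqxx.
  by [].
move=> f f2 eps eps0.
have F2 := (memL2_restrict f mA).1 f2.
have [s [d [sL sd]]] := dense _ F2 eps eps0.
(* Only terms with time [t] are kept: on [translate Omega t] the others vanish by [tile_disj], so
   the error there is that of the full combination. *)
exists [seq l.2 | l <- s & l.1 == t], (fun nu => d (t, nu)); split.
  by move=> nu /mapP[[t' nu']]; rewrite mem_filter => /andP[/= /eqP -> /sL L1 ->].
apply: le_lt_trans sd.
pose F (x : R) := chi (translate Omega t) x * f x - \sum_(l <- s) d l * gab l x.
rewrite -[leRHS]/(norm2sq setT F).
have -> : norm2sq (translate Omega t) (fun x => f x - \sum_(nu <- [seq l.2 | l <- s & l.1 == t]) d (t, nu) * character nu x) =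
  norm2sq (translate Omega t) F.
  apply: eq_integral => x; rewrite inE => xA; congr (_ ^+ 2)%:E; congr ComplexField.Normc.normc.
  rewrite /F /chi indicE mem_set// mul1r; congr (_ - _).
  rewrite big_map big_filter big_mkcond; apply: eq_big_seq => -[t' nu'] ls /=.
  case: ifPn => [/eqP ->|tt'].
    by rewrite -gaborE /chi indicE mem_set// mul1r.
  rewrite /gabor /chi indicE memNset ?mul0r ?mulr0//= => inO.
  have /= E := tile_disj (sL _ ls) L0 inO ((translateP t x).1 xA).
  by move: tt'; rewrite E eqxx.
rewrite /norm2sq; apply: ge0_subset_integral => //; last by move=> x _; rewrite lee_fin sqr_ge0.
have [m1 m2 _] := F2.
have [[M [m3 _ _]] [N [m4 _ _]]] : bcsC (fun x => \sum_(l <- s) d l * gab l x).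
  by apply: bcsC_sum => l; apply: bcsCZ; exact: bcsC_gabor.
apply/measurable_EFinP.
rewrite (_ : (fun x => _) = (fun x => sqnorm (F x))); last by apply/funext => x; rewrite sqnormE.
rewrite /sqnorm /F; apply: measurable_funD; apply: measurable_funX.
  rewrite (_ : (fun x => _) = (fun x => complex.Re (chi (translate Omega t) x * f x) -
     complex.Re (\sum_(l <- s) d l * gab l x))); first exact: measurable_funB.
  by apply/funext => x; rewrite ReD ReN.
rewrite (_ : (fun x => _) = (fun x => complex.Im (chi (translate Omega t) x * f x) -
   complex.Im (\sum_(l <- s) d l * gab l x))); first exact: measurable_funB.
by apply/funext => x; rewrite ImD ImN.
Qed.

End Structure.

Unset Implicit Arguments.
Set Strict Implicit.

Theorem theorem4p7 (R : realType) (alpha beta : R) (Lambda : set (R * R)%type)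
    (halpha0 : 0 < alpha) (halpha : alpha < 1 / 2) (hbeta : 0 < beta)
    (hdiscrete : Lambda `<=` isolated Lambda) (hcount : countable Lambda)
    (honb : gabor_onb (chi (two_intervals alpha beta)) Lambda) :
  standard (two_intervals alpha beta) Lambda /\
  exists (t0 : R) (a : int -> R),
    [/\ 0 <= t0 < 1,
        forall k : int, 0 <= a k < 1,
        Lambda = integer_fibres t0 a &
        (exists (k : int) (nu : R), Lambda (k%:~R, nu)) ->
          Lambda = integer_fibres 0 a].
Proof.
split; first exact: (gabor_standard halpha0 halpha hbeta honb hcount).
exact: (gabor_integer_fibres halpha0 halpha hbeta honb hcount).
Qed.
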